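(* Let $N=\{N_t\}_{t\ge0}$ be a standard Poisson process. For any real-valued Lévy process $X=\{X_s\}_{s\ge0}$ with characteristic exponent $\Phi$ and any $\alpha\in\mathbb R$ and $\lambda,v>0$ we have $$\mathbb E\Big[e^{\lambda\int_0^ve^{\mathrm i\alpha X_u}\,\mathrm du}\,\Big|\,X_0=0\Big]=e^{\lambda v}\sum_{n\ge0}\mathbb E\Big[e^{-\frac1\lambda\int_0^{\lambda v}\Phi(\alpha(n-N_u))\,\mathrm du}\,\mathbf 1_{\{N_{\lambda v}=n\}}\,\Big|\,N_0=0\Big].$$
   Context: The characteristic exponent $\Phi$ of the Lévy process $X$ is defined by $\mathbb E[e^{\mathrm iyX_s}\mid X_0=0]=e^{-s\Phi(y)}$, $s\ge0$, $y\in\mathbb R$. A standard Poisson process has rate $1$. *)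

(* Defs.v *)
From HB Require Import structures.
From mathcomp Require Export all_boot all_order all_algebra.
From mathcomp Require Export all_classical all_reals all_analysis.
From mathcomp Require Export complex.
Export Order.TTheory GRing.Theory Num.Theory.
Export numFieldNormedType.Exports.

Set Implicit Arguments.
Unset Strict Implicit.
Unset Printing Implicit Defensive.

Local Open Scope classical_set_scope.
Local Open Scope ring_scope.
Local Open Scope complex_scope.

Section Complex.
Variable R : realType.

Definition cexp (z : R[i]) : R[i] :=
  (expR (complex.Re z))%:C
  * (cos (complex.Im z) +i* sin (complex.Im z)).

(* Integral of a complex-valued function, componentwise; the real integral
   [Rintegral] is [0] when its extended-real value is infinite. *)
Definition cintegral d (T : measurableType d) (mu : {measure set T -> \bar R})
    (D : set T) (f : T -> R[i]) : R[i] :=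
  (\int[mu]_(x in D) complex.Re (f x)) +i* (\int[mu]_(x in D) complex.Im (f x)).

(* E[f | A] for an event A of positive probability. *)
Definition cond_expectation d (T : measurableType d) (P : probability T R)
    (A : set T) (f : T -> R[i]) : R[i] :=
  ((fine (P A))^-1)%:C * cintegral P A f.

End Complex.

Section Processes.
Context (R : realType) d (T : measurableType d) (P : probability T R).

Definition mutually_independent (n : nat) (Y : nat -> T -> R) : Prop :=
  forall B : nat -> set R, (forall i, measurable (B i)) ->
    P (\bigcap_(i in `I_n) (Y i @^-1` B i))
    = (\prod_(i < n) P (Y i @^-1` B i))%E.

Definition increments (X : R -> T -> R) (t : nat -> R) (i : nat) : T -> R :=
  if i is j.+1 then X (t j.+1) \- X (t j) else X (t 0%N).

Definition cadlag (f : R -> R) : Prop :=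
  (forall t, 0 <= t -> f x @[x --> t^'+] --> f t)
  /\ (forall t, 0 < t -> cvg (f x @[x --> t^'-])).

(* The law of [X 0] is arbitrary, so that conditioning on [X 0 = 0] is
   meaningful; it is independent of the later increments, as the family in the
   second clause starts with [X (t 0)] itself. Times are the reals [t >= 0]; the
   values of [X] at negative times are unconstrained. *)
Definition levy_process (X : R -> T -> R) : Prop :=
  [/\ forall t, 0 <= t -> measurable_fun setT (X t),
      forall (n : nat) (t : nat -> R), 0 <= t 0%N -> nondecreasing_seq t ->
        mutually_independent n (increments X t),
      forall (s t : R) (B : set R), 0 <= s -> 0 <= t -> measurable B ->
        P ((X (s + t) \- X s) @^-1` B) = P ((X t \- X 0) @^-1` B)
    & {ae P, forall w, cadlag (X ^~ w)}].

Definition characteristic_exponent (X : R -> T -> R) (Phi : R -> R[i]) : Prop :=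
  forall s y : R, 0 <= s ->
    cond_expectation P [set w | X 0 w = 0]
      (fun w => cexp ('i%C * (y * X s w)%:C))
    = cexp (- (s%:C * Phi y)).

Definition standard_poisson_process (N : R -> T -> nat) : Prop :=
  levy_process (fun t w => (N t w)%:R)
  /\ forall (s t : R) (k : nat), 0 <= s -> s < t ->
       P [set w | N t w = (N s w + k)%N] = (poisson_pmf (t - s) k)%:E.

End Processes.

(* Main.v *)
(* Cut [0, v] into m cells of length h = v / m and put delta = lambda * h. The
   n-th term of the expansion of E[exp (delta * sum_i exp (i alpha X_(i h)))] is,
   by the multinomial theorem, a sum over tuples k with sum n of the products
   prod_i delta^(k_i) / k_i! * E[exp (i alpha sum_i k_i X_(i h))]. The weights are,
   up to the factor exp delta, Poisson probabilities, so k is the sequence of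
   increments of N over the cells of [0, lambda v]; and Abel summation with the
   independence of the increments of X turns the expectation into
   prod_i exp (- h Phi (alpha (n - (k_1 + ... + k_(i-1))))). Hence the two sides
   of the formula, with integrals replaced by Riemann sums, agree exactly for
   each n and m. Let m tend to infinity with n fixed by bounded convergence, and
   then sum over n. *)

(* Regularity is the obstacle. Paths are regular only almost surely, so neither time integral need
   be a random variable, and continuity of [Phi] is never derived. The only functionals shown to be
   measurable are therefore finite sums and their limits off a null set, and the bounded convergence
   lemmas ask nothing of the limit function. On the event N_(lambda v) = n the values of N at the
   nodes lie in {0, ..., n} almost surely, so [Phi] enters there only through the finitely many
   numbers Phi (alpha (n - l)) with l <= n. This gives the bound for n fixed. It also gives the
   convergence: an integer-valued right-continuous path is constant just after each time, so [Phi]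
   composed with it is right-continuous too. Sampling X at right ends of cells makes Abel summation
   produce the values of N at left ends. The two kinds of Riemann sum differ by a telescoping term
   that vanishes with the mesh. The factor 1 / lambda comes from the two clocks: a cell of length h
   for X is a cell of length lambda h for N. *)
Require Import Defs.
From mathcomp Require Import measurable_realfun ring lra.

Set Implicit Arguments.
Unset Strict Implicit.
Unset Printing Implicit Defensive.

Local Open Scope classical_set_scope.
Local Open Scope ring_scope.
Local Open Scope complex_scope.

(** * Integrals up to null sets *)

Section IntegralOffNullSet.
Context d (T : measurableType d) (R : realType) (mu : {measure set T -> \bar R}).
Import HBNNSimple.

(* [integral] is a supremum over the simple functions below, and these can be
   set to zero on the null set; this covers non-measurable [f] and [g], such as
   functionals of paths that are regular only almost surely. *)
Lemma integral_off_null (D Z : set T) (f g : T -> \bar R) :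
  measurable Z -> mu Z = 0%E ->
  (forall x, D x -> ~ Z x -> f x = g x) ->
  (\int[mu]_(x in D) f x = \int[mu]_(x in D) g x)%E.
Proof.
move=> mZ Z0.
(* By symmetry one inequality is enough. Each simple [h] below [f'] is cut to zero on [Z], which
   keeps its integral; there it lies below [g'] because [g'] is nonnegative. *)
have sub (f' g' : T -> \bar R) : (forall x, (0 <= g' x)%E) ->
    (forall x, ~ Z x -> (f' x <= g' x)%E) ->
    (ereal_sup [set sintegral mu h |
        h in [set h : {nnsfun T >-> R} | forall x, ((h x)%:E <= f' x)%E]] <=
     ereal_sup [set sintegral mu h |
        h in [set h : {nnsfun T >-> R} | forall x, ((h x)%:E <= g' x)%E]])%E.
  move=> g0 fg; apply: ge_ereal_sup => _ [h /= hf <-].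
  have mZC : measurable (~` Z) by exact: measurableC.
  pose h' := proj_nnsfun h mZC.
  have -> : sintegral mu h = sintegral mu h'.
    rewrite -!integralT_nnsfun; apply: ge0_ae_eq_integral => //.
    - exact/measurable_EFinP.
    - exact/measurable_EFinP.
    - by move=> x _; rewrite lee_fin.
    - by move=> x _; rewrite lee_fin.
    exists Z; split=> // x /=; apply: contra_notP => nZx _.
    by rewrite /h' /= mindicE mem_set// mulr1.
  apply: ereal_sup_ubound; exists h' => //= x.
  rewrite mindicE; case: (boolP (x \in ~` Z)) => [|_]; last by rewrite mulr0.
  by rewrite inE mulr1 => nZx; rewrite (le_trans (hf x))// fg.
move=> fg; rewrite /integral.
have fgD x : ~ Z x -> (f \_ D) x = (g \_ D) x.
  by move=> nZx; rewrite !patchE; case: ifPn => //; rewrite inE => Dx; apply: fg.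
congr (_ - _)%E; apply/eqP; rewrite eq_le; apply/andP; split; apply: sub => //;
  by move=> x nZx; rewrite ?funeposE ?funenegE fgD.
Qed.

Lemma Rintegral_off_null (D Z : set T) (f g : T -> R) :
  measurable Z -> mu Z = 0%E -> (forall x, D x -> ~ Z x -> f x = g x) ->
  \int[mu]_(x in D) f x = \int[mu]_(x in D) g x.
Proof.
move=> mZ Z0 fg; congr fine; apply: (integral_off_null mZ Z0) => x Dx nZx.
by rewrite fg.
Qed.

Lemma bounded_integrable (D : set T) (f : T -> R) (C : R) :
  measurable D -> (mu D < +oo)%E -> measurable_fun setT f ->
  (forall x, D x -> `|f x| <= C) -> mu.-integrable D (EFin \o f).
Proof.
move=> mD Doo mf fC; apply: measurable_bounded_integrable => //.
  exact: measurable_funTS.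
exists C; split; first exact: num_real.
by move=> M CM x Dx; exact: le_trans (fC x Dx) (ltW CM).
Qed.

(** No measurability is asked of [f]: cut to zero outside [D] minus [Z] it becomes a pointwise limit
    of measurable functions, and the cut does not change its integral over [D]. *)
Lemma Rintegral_bounded_cvg (D Z : set T) (f_ : nat -> T -> R) (f : T -> R)
    (C : R) :
  measurable D -> (mu D < +oo)%E -> measurable Z -> mu Z = 0%E ->
  (forall n, measurable_fun setT (f_ n)) ->
  (forall n x, D x -> ~ Z x -> `|f_ n x| <= C) ->
  (forall x, D x -> ~ Z x -> f_ ^~ x @ \oo --> f x) ->
  \int[mu]_(x in D) f_ n x @[n --> \oo] --> \int[mu]_(x in D) f x.
Proof.
move=> mD Doo mZ Z0 mf_ f_C f_f.
have mDZ : measurable (D `\` Z) by exact: measurableD.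
pose f' := f \_ (D `\` Z).
pose g n := f_ n \_ (D `\` Z).
have mg n : measurable_fun setT (g n).
  by apply/(measurable_restrictT _ _).1 => //; exact: measurable_funTS.
have gf x : g ^~ x @ \oo --> f' x.
  rewrite /g /f' patchE; case: ifPn => [|xn].
    rewrite inE => -[Dx nZx]; under eq_fun do rewrite patchE mem_set//.
    exact: f_f.
  by under eq_fun do rewrite patchE (negbTE xn); exact: cvg_cst.
have mf' : measurable_fun setT f'.
  by apply: (measurable_fun_cvg mg) => x _; exact: gf.
have E n : \int[mu]_(x in D) f_ n x = \int[mu]_(x in D) g n x.
  by apply: (Rintegral_off_null mZ Z0) => x Dx nZx; rewrite /g patchE mem_set.
have -> : \int[mu]_(x in D) f x = \int[mu]_(x in D) f' x.
  by apply: (Rintegral_off_null mZ Z0) => x Dx nZx; rewrite /f' patchE mem_set.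
under eq_fun do rewrite E.
(* The absolute value is taken because [C] may be negative when [D] minus [Z] is empty, while [g n]
   is still 0. *)
have gC n x : `|g n x| <= `|C|.
  rewrite /g patchE; case: ifPn => [|_]; last by rewrite normr0.
  by rewrite inE => -[Dx nZx]; rewrite (le_trans (f_C n x Dx nZx))// ler_norm.
have := @dominated_convergence _ _ _ mu D mD (fun n => EFin \o g n) (EFin \o f')
  (EFin \o cst `|C|).
case.
- by move=> n; apply/measurable_EFinP; exact: measurable_funTS.
- by apply/measurable_EFinP; exact: measurable_funTS.
- by apply: aeW => x Dx /=; apply: cvg_EFin; [exact: nearW|exact: gf].
- by apply: (@bounded_integrable _ _ `|C|) => // x _ /=; rewrite normr_id.
- by apply: aeW => x n Dx; rewrite /= lee_fin.
move=> intf' _ h; apply: fine_cvg.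
by rewrite /Rintegral fineK//; exact: integrable_fin_num.
Qed.

End IntegralOffNullSet.

(** * The complex exponential *)

Section ComplexLimits.
Variable R : realType.
Local Notation C := (R[i] : numFieldType).
Local Notation Re := (@complex.Re R).
Local Notation Im := (@complex.Im R).
Implicit Types (x y z : R[i]).

Lemma ReD x y : Re (x + y) = Re x + Re y. Proof. by case: x y => ? ? []. Qed.
Lemma ImD x y : Im (x + y) = Im x + Im y. Proof. by case: x y => ? ? []. Qed.
Lemma ReN x : Re (- x) = - Re x. Proof. by case: x. Qed.
Lemma ImN x : Im (- x) = - Im x. Proof. by case: x. Qed.
Lemma ReM x y : Re (x * y) = Re x * Re y - Im x * Im y.
Proof. by case: x y => ? ? []. Qed.
Lemma ImM x y : Im (x * y) = Re x * Im y + Im x * Re y.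
Proof. by case: x y => ? ? []. Qed.
Lemma Re_sum I (r : seq I) (P : pred I) (F : I -> R[i]) :
  Re (\sum_(i <- r | P i) F i) = \sum_(i <- r | P i) Re (F i).
Proof. by apply: big_morph => //; exact: ReD. Qed.
Lemma Im_sum I (r : seq I) (P : pred I) (F : I -> R[i]) :
  Im (\sum_(i <- r | P i) F i) = \sum_(i <- r | P i) Im (F i).
Proof. by apply: big_morph => //; exact: ImD. Qed.

Lemma complex_ext x y : Re x = Re y -> Im x = Im y -> x = y.
Proof. by case: x y => ? ? [? ?] /= -> ->. Qed.

Lemma norm_Re_le z : `|Re z|%:C <= `|z|.
Proof.
case: z => a b; rewrite normc_def lecR /= -sqrtr_sqr ler_wsqrtr//.
by rewrite lerDl sqr_ge0.
Qed.

Lemma norm_Im_le z : `|Im z|%:C <= `|z|.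
Proof.
case: z => a b; rewrite normc_def lecR /= -sqrtr_sqr ler_wsqrtr//.
by rewrite lerDr sqr_ge0.
Qed.

Lemma norm_real_complex (x : R) : `|x%:C| = `|x|%:C.
Proof. by rewrite normc_def /= expr0n/= addr0 sqrtr_sqr. Qed.

Lemma norm_le_ReIm z : `|z| <= (`|Re z| + `|Im z|)%:C.
Proof.
case: z => a b; rewrite normc_def lecR /=.
rewrite -[leRHS]ger0_norm ?addr_ge0// -sqrtr_sqr ler_wsqrtr//.
by rewrite sqrrD !real_normK ?num_real// -addrA lerD2l lerDr mulrn_wge0 ?mulr_ge0.
Qed.

(** The bridge between the two views in use: integrals are taken by components, series converge for
    the modulus. *)
Lemma cvg_complexP (u : nat -> C) (l : C) :
  u n @[n --> \oo] --> l <->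
  (Re (u n) @[n --> \oo] --> Re l /\ Im (u n) @[n --> \oo] --> Im l).
Proof.
split=> [ul|[ur ui]].
  split; apply/cvgrPdist_lt => e e0; move/cvgrPdist_lt : ul => /(_ e%:C);
    rewrite ltcR => /(_ e0); apply: filterS => n; rewrite -ltcR -?ReN -?ImN -?ReD -?ImD;
    apply: le_lt_trans; [exact: norm_Re_le|exact: norm_Im_le].
(* In the order of [R[i]], a positive radius is a real one: its imaginary part vanishes. *)
apply/cvgrPdist_lt => -[e e']; rewrite ltcE/= => /andP[/eqP -> e0].
have e20 : 0 < e / 2 by rewrite divr_gt0.
move/cvgrPdist_lt : ur => /(_ _ e20) ur; move/cvgrPdist_lt : ui => /(_ _ e20) ui.
near=> n; rewrite (le_lt_trans (norm_le_ReIm _))// ltcR ReD ImD ReN ImN.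
rewrite [ltRHS](splitr e) ltrD//; near: n; [exact: ur|exact: ui].
Unshelve. all: by end_near. Qed.

Lemma cexpD x y : cexp (x + y) = cexp x * cexp y.
Proof.
rewrite /cexp ReD ImD expRD cosD sinD; apply: complex_ext; rewrite !(ReM, ImM)/=.
all: ring.
Qed.

Lemma cexp0 : cexp 0 = 1 :> R[i].
Proof.
by rewrite /cexp/= expR0 cos0 sin0 mul1r.
Qed.

Lemma cexp_sum I (r : seq I) (P : pred I) (F : I -> R[i]) :
  cexp (\sum_(i <- r | P i) F i) = \prod_(i <- r | P i) cexp (F i).
Proof. by apply: big_morph; [exact: cexpD|exact: cexp0]. Qed.

Lemma cexpMn x n : cexp (x *+ n) = cexp x ^+ n.
Proof. by elim: n => [|n IH]; rewrite ?cexp0// mulrS exprS cexpD IH. Qed.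

Lemma cexp_real (x : R) : cexp x%:C = (expR x)%:C.
Proof. by rewrite /cexp /= cos0 sin0; simpc. Qed.

Lemma cexp_i (x : R) : cexp ('i%C * x%:C) = cos x +i* sin x.
Proof.
have -> : 'i%C * x%:C = 0 +i* x by apply: complex_ext; rewrite ?(ReM, ImM)/=; ring.
by rewrite /cexp/= expR0; apply: complex_ext; rewrite ?(ReM, ImM)/=; ring.
Qed.

Lemma norm_lim_le (u : nat -> C) (l : C) (K : R) :
  u n @[n --> \oo] --> l -> (forall n, `|u n| <= K%:C) -> `|l| <= K%:C.
Proof.
move=> /cvg_norm/cvg_complexP[ul _] uK.
have -> : `|l| = (Re `|l|)%:C by rewrite normc_def.
rewrite lecR -(cvg_lim _ ul)//; apply: limr_le; first exact: cvgP ul.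
by apply: nearW => n; have := uK n; rewrite lecE => /andP[].
Qed.

Lemma norm_cexp z : `|cexp z| = (expR (Re z))%:C.
Proof.
rewrite /cexp normrM !normc_def /= !expr0n/= addr0 sqrtr_sqr cos2Dsin2 sqrtr1 mulr1.
by rewrite ger0_norm ?expR_ge0.
Qed.

Lemma norm_cexp_i (x : R) : `|cexp ('i%C * x%:C)| = 1.
Proof. by rewrite norm_cexp ReM /= mul0r mulr0 subrr expR0. Qed.

Lemma cexp_neq0 z : cexp z != 0.
Proof.
rewrite -normr_eq0 norm_cexp; apply/eqP => /(congr1 (Re))/= e.
by have := expR_gt0 (Re z); rewrite e ltxx.
Qed.

Lemma continuous_cexp (u : nat -> C) (l : C) :
  u n @[n --> \oo] --> l -> (cexp (u n) : C) @[n --> \oo] --> (cexp l : C).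
Proof.
move=> /cvg_complexP[ur ui]; apply/cvg_complexP.
have er : expR (Re (u n)) @[n --> \oo] --> expR (Re l).
  by apply: continuous_cvg => //; exact: continuous_expR.
have ec : cos (Im (u n)) @[n --> \oo] --> cos (Im l).
  by apply: continuous_cvg => //; exact: continuous_cos.
have es : sin (Im (u n)) @[n --> \oo] --> sin (Im l).
  by apply: continuous_cvg => //; exact: continuous_sin.
by split; rewrite /cexp ?ReM ?ImM/=; under eq_fun do rewrite ?ReM ?ImM/=;
  [apply: cvgB|apply: cvgD]; apply: cvgM => //; exact: cvg_cst.
Qed.

End ComplexLimits.

Section ComplexExponentialSeries.
Variable R : realType.
Local Notation C := (R[i] : numFieldType).
Local Notation Re := (@complex.Re R).
Local Notation Im := (@complex.Im R).

(** The induction step of a Taylor estimate, without integration: the mean value theorem is applied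
    to the monomial c x^(n+1) / (n+1)! minus [f], whose derivative is nonnegative on [0, t], and
    then with [- f] for [f]. *)
Lemma norm_le_monomial (f f' : R -> R) (c : R) (n : nat) (t : R) :
  (forall x : R, is_derive x (1 : R) f (f' x)) -> f 0 = 0 ->
  (forall x, 0 <= x <= t -> `|f' x| <= c * (x ^+ n / n`!%:R)) -> 0 <= t ->
  `|f t| <= c * (t ^+ n.+1 / n.+1`!%:R).
Proof.
have aux (g g' : R -> R) : (forall x : R, is_derive x (1 : R) g (g' x)) -> g 0 = 0 ->
    (forall x, 0 <= x <= t -> `|g' x| <= c * (x ^+ n / n`!%:R)) -> 0 <= t ->
    g t <= c * (t ^+ n.+1 / n.+1`!%:R).
  move=> dg g0 g'le t0.
  pose p : {poly R} := (c / n.+1`!%:R) *: 'X^(n.+1).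
  have pE x : p.[x] = c * (x ^+ n.+1 / n.+1`!%:R).
    by rewrite /p hornerZ hornerXn mulrAC mulrA.
  have p'E x : p^`().[x] = c * (x ^+ n / n`!%:R).
    rewrite /p derivZ derivXn hornerZ hornerMn hornerXn factS natrM -mulr_natr.
    by field; rewrite nat1r !pnatr_eq0/= -lt0n fact_gt0.
  have dh (x : R) : is_derive x (1:R) (horner p - g) (p^`().[x] - g' x).
    exact: is_deriveB.
  have [|x] := @MVT_segment R (horner p - g) (fun x => p^`().[x] - g' x) 0 t t0
    (fun x _ => dh x).
    by apply: derivable_within_continuous => x _; have [] := dh x.
  rewrite in_itv/= => xt.
  rewrite /GRing.sub_fun /= !fctE /= g0 !pE expr0n/= mul0r mulr0 !subr0 => E.
  rewrite -subr_ge0 E mulr_ge0// subr_ge0 p'E.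
  exact: le_trans (ler_norm _) (g'le x xt).
move=> df f0 f'le t0; rewrite ler_norml lerNl; apply/andP; split.
  apply: (aux (- f) (fun x => - f' x)) => //; rewrite ?fctE ?f0 ?oppr0//.
  by move=> x xt; rewrite normrN f'le.
exact: (aux f f').
Qed.

(** With [part] the real or imaginary part, this is that component of the Taylor polynomial of exp
    (t z) in the real variable t. *)
Let expp (z : R[i]) (part : R[i] -> R) (m : nat) : {poly R} :=
  \poly_(k < m) (part (z ^+ k) / k`!%:R).

Let deriv_expp (z : R[i]) part m : (expp z part m.+1)^`() =
  \poly_(k < m) (part (z * z ^+ k) / k`!%:R).
Proof.
apply/polyP => k; rewrite coef_deriv !coef_poly ltnS; case: ifPn => _; last first.
  by rewrite mul0rn.
rewrite exprS factS natrM -mulr_natr.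
by field; rewrite nat1r !pnatr_eq0/= -lt0n fact_gt0.
Qed.

(** The two components are estimated together because differentiating exp (t z) multiplies by z,
    which mixes them. Each differentiation costs a factor [|Re z| + |Im z|], and t <= 1 keeps exp (t
    Re z) below exp |Re z|. *)
Lemma cexp_taylor (z : R[i]) (m : nat) (t : R) : 0 <= t <= 1 ->
  let K := expR `|Re z| * (`|Re z| + `|Im z|) ^+ m in
  `|expR (Re z * t) * cos (Im z * t) - (expp z Re m).[t]| <= K * (t ^+ m / m`!%:R)
  /\
  `|expR (Re z * t) * sin (Im z * t) - (expp z Im m).[t]| <= K * (t ^+ m / m`!%:R).
Proof.
elim: m t => [|m IH] t /andP[t0 t1] K; rewrite {}/K.
  have zt : expR (Re z * t) <= expR `|Re z|.
    rewrite ler_expR (le_trans (ler_norm _))// normrM (ger0_norm t0).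
    by rewrite -[leRHS]mulr1 ler_wpM2l.
  rewrite /expp !poly_def !big_ord0 !horner0 !subr0 !expr0 !mulr1 divr1 mulr1.
  rewrite !normrM (ger0_norm (expR_ge0 _)).
  by split; rewrite -[leRHS]mulr1 ler_pM ?cos_max ?sin_max ?expR_ge0.
pose a := Re z; pose b := Im z.
have dlin c x : is_derive x (1 : R) (fun t => c * t) c.
  have : is_derive x (1 : R) (c \*: (@id R)) (c *: 1) by exact: is_deriveZ.
  by rewrite /GRing.scale/= mulr1.
have dea x : is_derive x (1 : R) (fun t => expR (a * t)) (expR (a * x) * a).
  exact: (@is_derive1_comp R expR (fun t => a * t)).
have dcos (x : R) : is_derive x (1:R) (fun t => cos (b * t)) (- sin (b * x) * b).
  exact: (@is_derive1_comp R cos (fun t => b * t)).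
have dsin (x : R) : is_derive x (1:R) (fun t => sin (b * t)) (cos (b * x) * b).
  exact: (@is_derive1_comp R sin (fun t => b * t)).
have bound x y r : `|x| <= r -> `|y| <= r -> 0 <= r ->
    `|a * x - b * y| <= (`|a| + `|b|) * r.
  move=> xr yr r0; rewrite (le_trans (ler_normB _ _))// !normrM mulrDl.
  by rewrite lerD// ler_wpM2l.
have bound' x y r : `|x| <= r -> `|y| <= r -> 0 <= r ->
    `|a * x + b * y| <= (`|a| + `|b|) * r.
  move=> xr yr r0; rewrite (le_trans (ler_normD _ _))// !normrM mulrDl.
  by rewrite lerD// ler_wpM2l.
have K0 x : 0 <= x -> 0 <= expR `|a| * (`|a| + `|b|) ^+ m * (x ^+ m / m`!%:R).
  by move=> x0; rewrite !mulr_ge0 ?expR_ge0 ?exprn_ge0 ?addr_ge0 ?invr_ge0 ?ler0n.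
rewrite exprSr; split.
  (* The real part of z times the complex remainder of order m; the imaginary part appears in the
     second half. *)
  pose f' x := a * (expR (a * x) * cos (b * x) - (expp z Re m).[x]) -
               b * (expR (a * x) * sin (b * x) - (expp z Im m).[x]).
  have := @norm_le_monomial
    (fun t => expR (a * t) * cos (b * t) - (expp z Re m.+1).[t]) f'
    (expR `|a| * ((`|a| + `|b|) ^+ m * (`|a| + `|b|))) m t; apply => //.
  - move=> x; have h := is_deriveB (is_deriveM (dea x) (dcos x))
      (is_derive_poly (expp z Re m.+1) x).
    apply: (is_derive_eq h).
    rewrite deriv_expp.
    have -> : \poly_(k < m) (Re (z * z ^+ k) / k`!%:R) =
        a *: expp z Re m - b *: expp z Im m.
      apply/polyP => k; rewrite coefB !coefZ !coef_poly; case: ifPn => _.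
        by rewrite ReM mulrBl !mulrA.
      by rewrite !mulr0 subr0.
    rewrite hornerD hornerN !hornerZ /f' /GRing.scale /=; ring.
  - rewrite !mulr0 expR0 cos0 mulr1 horner_coef0 coef_poly/= divr1.
    by rewrite subrr.
  - move=> x /andP[x0 xt].
    have [|h1 h2] := IH x; first by rewrite x0 (le_trans xt).
    rewrite /f' (le_trans (bound _ _ _ h1 h2 (K0 _ x0)))//.
    by rewrite le_eqVlt; apply/orP; left; apply/eqP; ring.
pose f' x := a * (expR (a * x) * sin (b * x) - (expp z Im m).[x]) +
             b * (expR (a * x) * cos (b * x) - (expp z Re m).[x]).
have := @norm_le_monomial
  (fun t => expR (a * t) * sin (b * t) - (expp z Im m.+1).[t]) f'
  (expR `|a| * ((`|a| + `|b|) ^+ m * (`|a| + `|b|))) m t; apply => //.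
- move=> x; have h := is_deriveB (is_deriveM (dea x) (dsin x))
    (is_derive_poly (expp z Im m.+1) x).
  apply: (is_derive_eq h).
  rewrite deriv_expp.
  have -> : \poly_(k < m) (Im (z * z ^+ k) / k`!%:R) =
      a *: expp z Im m + b *: expp z Re m.
    apply/polyP => k; rewrite coefD !coefZ !coef_poly; case: ifPn => _.
      by rewrite ImM mulrDl !mulrA.
    by rewrite !mulr0 addr0.
  rewrite hornerD !hornerZ /f' /GRing.scale /=; ring.
- rewrite !mulr0 expR0 sin0 mulr0 horner_coef0 coef_poly/= divr1.
  by rewrite subrr.
- move=> x /andP[x0 xt].
  have [|h1 h2] := IH x; first by rewrite x0 (le_trans xt).
  rewrite /f' (le_trans (bound' _ _ _ h2 h1 (K0 _ x0)))//.
  by rewrite le_eqVlt; apply/orP; left; apply/eqP; ring.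
Qed.

Lemma complex_natrV (k : nat) : (k%:R)^-1 = ((k%:R)^-1)%:C :> R[i].
Proof. by rewrite -(rmorph_nat (real_complex R)) fmorphV. Qed.

(** [cexp] is defined from the real exponential, cosine and sine. Its power series is the Taylor
    estimate along the ray t z, taken at t = 1. *)
Lemma cexp_series (z : R[i]) :
  (\sum_(k < m) (k`!%:R)^-1 * z ^+ k : C) @[m --> \oo] --> (cexp z : C).
Proof.
pose c := `|Re z| + `|Im z|.
have Kto0 : expR `|Re z| * (c ^+ m / m`!%:R) @[m --> \oo] --> (0 : R).
  by rewrite -[X in _ --> X](mulr0 (expR `|Re z|)); apply: cvgM;
    [exact: cvg_cst|exact: cvg_exp_coeff].
have sum (part : R[i] -> R) :
    (forall I (r : seq I) (P : pred I) (F : I -> R[i]),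
      part (\sum_(i <- r | P i) F i) = \sum_(i <- r | P i) part (F i)) ->
    (forall (x : R) y, part (x%:C * y) = x * part y) -> forall m,
    part (\sum_(k < m) (k`!%:R)^-1 * z ^+ k) = (expp z part m).[1].
  move=> psum pZ m; rewrite psum /expp horner_poly; apply: eq_bigr => k _.
  by rewrite complex_natrV pZ expr1n mulr1 mulrC.
have key (u : nat -> R) (l : R) :
    (forall m, `|l - u m| <= expR `|Re z| * (c ^+ m / m`!%:R)) ->
    u m @[m --> \oo] --> l.
  move=> ul; apply/cvgrPdist_lt => e e0; move/cvgrPdist_lt : Kto0 => /(_ e e0).
  apply: filterS => m; rewrite sub0r normrN => h.
  exact: le_lt_trans (ul m) (le_lt_trans (ler_norm _) h).
have T m := @cexp_taylor z m 1 (introT andP (conj ler01 (lexx _))).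
apply/cvg_complexP; split.
  apply: key => m; rewrite (sum Re) //; last by move=> x y; rewrite ReM /= mul0r subr0.
    have [+ _] := T m; rewrite /cexp ReM/= !mulr1 mul0r subr0 expr1n mul1r.
    by rewrite mulrA.
  exact: Re_sum.
apply: key => m; rewrite (sum Im) //; last by move=> x y; rewrite ImM /= mul0r addr0.
  have [_] := T m; rewrite /cexp ImM/= !mulr1 mul0r addr0 expr1n mul1r.
  by rewrite mulrA.
exact: Im_sum.
Qed.

End ComplexExponentialSeries.

(** * Integrals of bounded complex functions *)

Section BoundedMeasurable.
Context d (T : measurableType d) (R : realType).
Local Notation C := (R[i] : numFieldType).
Local Notation Re := (@complex.Re R).
Local Notation Im := (@complex.Im R).
Implicit Types (f g : T -> R[i]).

(** The bound holds everywhere rather than almost everywhere, so the class is closed under sums,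
    products and composition with measurable maps, and integrability on a set of finite measure is
    automatic. *)
Definition bounded_measurable f :=
  [/\ measurable_fun setT (Re \o f), measurable_fun setT (Im \o f)
    & exists K : R, forall x, `|Re (f x)| <= K /\ `|Im (f x)| <= K].

Lemma bounded_measurable_cst (c : R[i]) : bounded_measurable (fun=> c).
Proof.
split; [exact: measurable_cst|exact: measurable_cst|].
exists (Num.max `|Re c| `|Im c|) => x.
by rewrite !le_max !lexx orbT.
Qed.

Lemma bounded_measurable_real (f : T -> R) (K : R) :
  measurable_fun setT f -> (forall x, `|f x| <= K) ->
  bounded_measurable (fun x => (f x)%:C).
Proof.
move=> mf fK; split; [exact: mf|exact: measurable_cst|].
by exists K => x; rewrite normr0; split=> //; exact: le_trans (fK x).
Qed.

Lemma bounded_measurable_indic (A : set T) : measurable A ->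
  bounded_measurable (fun x => (\1_A x : R)%:C).
Proof.
move=> mA; apply: (@bounded_measurable_real _ 1); first exact: measurable_indic.
by move=> x; rewrite indicE; case: (_ \in _); rewrite ?normr1 ?normr0.
Qed.

Lemma bounded_measurableD f g : bounded_measurable f -> bounded_measurable g ->
  bounded_measurable (fun x => f x + g x).
Proof.
move=> [mrf mif [K fK]] [mrg mig [L gL]]; split.
- rewrite (_ : Re \o _ = (Re \o f) \+ (Re \o g)); first exact: measurable_funD.
  by apply/funext => x /=; rewrite ReD.
- rewrite (_ : Im \o _ = (Im \o f) \+ (Im \o g)); first exact: measurable_funD.
  by apply/funext => x /=; rewrite ImD.
- exists (K + L) => x; have [? ?] := fK x; have [? ?] := gL x.
  by rewrite ReD ImD; split; rewrite (le_trans (ler_normD _ _))// lerD.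
Qed.

Lemma bounded_measurableM f g : bounded_measurable f -> bounded_measurable g ->
  bounded_measurable (fun x => f x * g x).
Proof.
move=> [mrf mif [K fK]] [mrg mig [L gL]]; split.
- rewrite (_ : Re \o _ = ((Re \o f) \* (Re \o g)) \- ((Im \o f) \* (Im \o g))).
    by apply: measurable_funB; exact: measurable_funM.
  by apply/funext => x /=; rewrite ReM.
- rewrite (_ : Im \o _ = ((Re \o f) \* (Im \o g)) \+ ((Im \o f) \* (Re \o g))).
    by apply: measurable_funD; exact: measurable_funM.
  by apply/funext => x /=; rewrite ImM.
- exists (K * L + K * L) => x; have [? ?] := fK x; have [? ?] := gL x.
  rewrite ReM ImM; split.
    by apply: le_trans (ler_normB _ _) _; apply: lerD; rewrite normrM ler_pM.
  by apply: le_trans (ler_normD _ _) _; apply: lerD; rewrite normrM ler_pM.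
Qed.

Lemma bounded_measurable_sum I (r : seq I) (P : pred I) (F : I -> T -> R[i]) :
  (forall i, P i -> bounded_measurable (F i)) ->
  bounded_measurable (fun x => \sum_(i <- r | P i) F i x).
Proof.
move=> mF; elim: r => [|i r IH].
  rewrite (_ : (fun x => _) = fun=> 0); first exact: bounded_measurable_cst.
  by apply/funext => x; rewrite big_nil.
have [Pi|nPi] := boolP (P i).
  rewrite (_ : (fun x => _) = fun x => F i x + \sum_(j <- r | P j) F j x).
    by apply: bounded_measurableD => //; exact: mF.
  by apply/funext => x; rewrite big_cons Pi.
rewrite (_ : (fun x => _) = fun x => \sum_(j <- r | P j) F j x)//.
by apply/funext => x; rewrite big_cons (negbTE nPi).
Qed.

Lemma bounded_measurable_prod I (r : seq I) (P : pred I) (F : I -> T -> R[i]) :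
  (forall i, P i -> bounded_measurable (F i)) ->
  bounded_measurable (fun x => \prod_(i <- r | P i) F i x).
Proof.
move=> mF; elim: r => [|i r IH].
  rewrite (_ : (fun x => _) = fun=> 1); first exact: bounded_measurable_cst.
  by apply/funext => x; rewrite big_nil.
have [Pi|nPi] := boolP (P i).
  rewrite (_ : (fun x => _) = fun x => F i x * \prod_(j <- r | P j) F j x).
    by apply: bounded_measurableM => //; exact: mF.
  by apply/funext => x; rewrite big_cons Pi.
rewrite (_ : (fun x => _) = fun x => \prod_(j <- r | P j) F j x)//.
by apply/funext => x; rewrite big_cons (negbTE nPi).
Qed.

Lemma bounded_measurableX f n : bounded_measurable f ->
  bounded_measurable (fun x => f x ^+ n).
Proof.
move=> mf; elim: n => [|n IH]; first exact: bounded_measurable_cst.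
by rewrite (_ : (fun x => _) = fun x => f x * f x ^+ n);
  [exact: bounded_measurableM|apply/funext => x; rewrite exprS].
Qed.

Lemma bounded_measurable_cexp_i (h : T -> R) : measurable_fun setT h ->
  bounded_measurable (fun x => cexp ('i%C * (h x)%:C)).
Proof.
move=> mh; split.
- rewrite (_ : Re \o _ = cos \o h); last by apply/funext => x; rewrite /comp cexp_i.
  apply: measurableT_comp mh; apply: continuous_measurable_fun.
  exact: continuous_cos.
- rewrite (_ : Im \o _ = sin \o h); last by apply/funext => x; rewrite /comp cexp_i.
  apply: measurableT_comp mh; apply: continuous_measurable_fun.
  exact: continuous_sin.
- by exists 1 => x; rewrite cexp_i cos_max sin_max.
Qed.

End BoundedMeasurable.

Lemma bounded_measurable_comp d (T : measurableType d) (R : realType)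
    (h : T -> R) (g : R -> R[i]) :
  measurable_fun setT h -> bounded_measurable g ->
  bounded_measurable (fun w => g (h w)).
Proof.
move=> mh [mr mi [K gK]]; split.
- exact: (measurableT_comp mr mh).
- exact: (measurableT_comp mi mh).
- by exists K => w.
Qed.

Lemma indic1C (T : Type) (R : realType) (A : set T) (w : T) :
  A w -> (\1_A w)%:C = 1 :> R[i].
Proof. by move=> Aw; rewrite indicE mem_set. Qed.

Lemma indic0C (T : Type) (R : realType) (A : set T) (w : T) :
  ~ A w -> (\1_A w)%:C = 0 :> R[i].
Proof. by move=> Aw; rewrite indicE memNset. Qed.

Section ComplexIntegral.
Context d (T : measurableType d) (R : realType) (mu : {measure set T -> \bar R}).
Local Notation C := (R[i] : numFieldType).
Local Notation Re := (@complex.Re R).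
Local Notation Im := (@complex.Im R).
Implicit Types (f g : T -> R[i]) (D Z A : set T).

Lemma eq_cintegral D f g : (forall x, D x -> f x = g x) ->
  cintegral mu D f = cintegral mu D g.
Proof.
move=> fg; rewrite /cintegral; congr (_ +i* _); apply: eq_Rintegral => x;
  by rewrite inE => Dx; rewrite fg.
Qed.

Lemma cintegral_off_null D Z f g : measurable Z -> mu Z = 0%E ->
  (forall x, D x -> ~ Z x -> f x = g x) -> cintegral mu D f = cintegral mu D g.
Proof.
move=> mZ Z0 fg; rewrite /cintegral.
by congr (_ +i* _); apply: (Rintegral_off_null mZ Z0) => x Dx nZx; rewrite fg.
Qed.

Lemma cintegral_mkcond D f :
  cintegral mu D f = cintegral mu setT (fun x => (\1_D x)%:C * f x).
Proof.
rewrite /cintegral [in LHS]Rintegral_mkcond [X in _ +i* X]Rintegral_mkcond.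
congr (_ +i* _); apply: eq_Rintegral => x _; rewrite patchE indicE ?ReM ?ImM;
  by case: ifPn => _; rewrite /= !(mul1r, mul0r, subr0, addr0).
Qed.

Variables (D : set T).
Hypotheses (mD : measurable D) (Doo : (mu D < +oo)%E).

Let intRe f : bounded_measurable f -> mu.-integrable D (EFin \o (Re \o f)).
Proof.
by move=> [mr _ [K fK]]; apply: (@bounded_integrable _ _ _ _ _ _ K) => // x _;
  case: (fK x).
Qed.

Let intIm f : bounded_measurable f -> mu.-integrable D (EFin \o (Im \o f)).
Proof.
by move=> [_ mi [K fK]]; apply: (@bounded_integrable _ _ _ _ _ _ K) => // x _;
  case: (fK x).
Qed.

Lemma cintegralD f g : bounded_measurable f -> bounded_measurable g ->
  cintegral mu D (fun x => f x + g x) = cintegral mu D f + cintegral mu D g.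
Proof.
move=> mf mg; apply: complex_ext; rewrite ?(ReD, ImD)/=.
  by rewrite -(RintegralD mD (intRe mf) (intRe mg)); apply: eq_Rintegral => x _; rewrite ReD.
by rewrite -(RintegralD mD (intIm mf) (intIm mg)); apply: eq_Rintegral => x _; rewrite ImD.
Qed.

Lemma cintegralZ (c : R[i]) f : bounded_measurable f ->
  cintegral mu D (fun x => c * f x) = c * cintegral mu D f.
Proof.
move=> mf; have ir := intRe mf; have ii := intIm mf.
have iZ (r : R) (h : T -> R) : mu.-integrable D (EFin \o h) ->
    mu.-integrable D (EFin \o (fun x => r * h x)).
  by move=> ih; have := integrableZl mD r ih.
apply: complex_ext; rewrite ?(ReM, ImM)/=; rewrite -!RintegralZl//.
  rewrite -RintegralB//; [|exact: iZ|exact: iZ].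
  by apply: eq_Rintegral => x _; rewrite ReM.
rewrite -RintegralD//; [|exact: iZ|exact: iZ].
by apply: eq_Rintegral => x _; rewrite ImM.
Qed.

Lemma cintegral_cst (c : R[i]) :
  cintegral mu D (fun=> c) = c * (fine (mu D))%:C.
Proof.
rewrite /cintegral !Rintegral_cst//; apply: complex_ext;
  by rewrite ?(ReM, ImM)/= mulr0 ?subr0 ?add0r.
Qed.

Lemma cintegral_indic (A : set T) : measurable A ->
  cintegral mu D (fun x => (\1_A x)%:C) = (fine (mu (A `&` D)))%:C.
Proof.
move=> mA; rewrite /cintegral /= Rintegral_cst// mul0r /Rintegral.
by rewrite integral_indic.
Qed.

Lemma cintegral_sum I (r : seq I) (P : pred I) (F : I -> T -> R[i]) :
  (forall i, P i -> bounded_measurable (F i)) ->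
  cintegral mu D (fun x => \sum_(i <- r | P i) F i x) =
  \sum_(i <- r | P i) cintegral mu D (F i).
Proof.
move=> mF; elim: r => [|i r IH].
  rewrite big_nil (@eq_cintegral _ _ (fun=> 0)); last by move=> x _; rewrite big_nil.
  by rewrite cintegral_cst mul0r.
rewrite big_cons; have [Pi|nPi] := boolP (P i).
  rewrite -IH -cintegralD; [|exact: mF|exact: bounded_measurable_sum].
  by apply: eq_cintegral => x _; rewrite big_cons Pi.
by rewrite -IH; apply: eq_cintegral => x _; rewrite big_cons (negbTE nPi).
Qed.

Lemma cintegral_bounded_cvg Z (f_ : nat -> T -> R[i]) f (K : R) :
  measurable Z -> mu Z = 0%E ->
  (forall n, bounded_measurable (f_ n)) ->
  (forall n x, D x -> ~ Z x -> `|f_ n x| <= K%:C) ->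
  (forall x, D x -> ~ Z x -> (f_ n x : C) @[n --> \oo] --> (f x : C)) ->
  (cintegral mu D (f_ n) : C) @[n --> \oo] --> (cintegral mu D f : C).
Proof.
move=> mZ Z0 mf fK fl; apply/cvg_complexP; split.
  apply: (@Rintegral_bounded_cvg _ _ _ mu D Z (fun n => Re \o f_ n) (Re \o f) K) => //.
  - by move=> n; have [] := mf n.
  - move=> n x Dx nZx; rewrite -lecR; exact: le_trans (norm_Re_le _) (fK n x Dx nZx).
  - by move=> x Dx nZx; have /cvg_complexP[] := fl x Dx nZx.
apply: (@Rintegral_bounded_cvg _ _ _ mu D Z (fun n => Im \o f_ n) (Im \o f) K) => //.
- by move=> n; have [] := mf n.
- move=> n x Dx nZx; rewrite -lecR; exact: le_trans (norm_Im_le _) (fK n x Dx nZx).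
- by move=> x Dx nZx; have /cvg_complexP[] := fl x Dx nZx.
Qed.

End ComplexIntegral.

(** * Independence *)

Section Transfer.
Context d (T : measurableType d) (R : realType) (P : probability T R).
Local Notation C := (R[i] : numFieldType).
Local Notation Re := (@complex.Re R).
Local Notation Im := (@complex.Im R).
Local Notation E := (cintegral P setT).

(** The sum counts the positive integers up to [x], so it is the integer part of [x]. After
    rescaling, a function with values in [0, 1] is uniformly close to an average of indicators of
    its level sets. *)
Lemma layer_cake_error (M : nat) (x : R) : 0 <= x <= M%:R ->
  `|x - \sum_(j < M) (j.+1%:R <= x)%R%:R| <= 1.
Proof.
elim: M => [|M IH] /andP[x0 xM].
  by rewrite big_ord0 subr0 ger0_norm// (le_trans xM) ?ler01.
rewrite big_ord_recr/=; have [xM1|xM1] := leP x M%:R.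
  have -> : (M.+1%:R <= x) = false.
    by apply/negbTE; rewrite -ltNge (le_lt_trans xM1)// ltr_nat.
  rewrite addr0.
  by apply: IH; rewrite x0.
have -> : \sum_(j < M) (j.+1%:R <= x)%R%:R = M%:R :> R.
  rewrite (eq_bigr (fun=> 1)) ?sumr_const ?card_ord// => j _.
  by rewrite (le_trans _ (ltW xM1)) ?ler_nat.
move: xM xM1; rewrite -natr1 => xM xM1.
case: (leP (M%:R + 1) x) => h; rewrite ler_norml /=; lra.
Qed.

Variables (H : T -> R[i]) (Y Y' : T -> R) (c : R[i]).
Hypotheses (mH : bounded_measurable H) (mY : measurable_fun setT Y)
  (mY' : measurable_fun setT Y').
Hypothesis HYc : forall B : set R, measurable B ->
  E (fun w => H w * (\1_B (Y w))%:C) = c * E (fun w => (\1_B (Y' w))%:C).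

Let transfers (g : R -> R[i]) :=
  E (fun w => H w * g (Y w)) = c * E (fun w => g (Y' w)).

Let PT : (P setT < +oo)%E. Proof. by rewrite probability_setT ltry. Qed.

Let transfersD g1 g2 : bounded_measurable g1 -> bounded_measurable g2 ->
  transfers g1 -> transfers g2 -> transfers (fun y => g1 y + g2 y).
Proof.
move=> m1 m2 t1 t2; rewrite /transfers.
have := cintegralD (mu := P) measurableT PT
  (bounded_measurableM mH (bounded_measurable_comp mY m1))
  (bounded_measurableM mH (bounded_measurable_comp mY m2)).
rewrite (@eq_cintegral _ _ _ _ _ (fun w => H w * g1 (Y w) + H w * g2 (Y w))
  (fun w => H w * (g1 (Y w) + g2 (Y w)))); last by move=> w _; rewrite mulrDr.
by rewrite t1 t2 cintegralD// ?mulrDr//; exact: bounded_measurable_comp.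
Qed.

Let transfersZ a g : bounded_measurable g ->
  transfers g -> transfers (fun y => a * g y).
Proof.
move=> m t; rewrite /transfers.
rewrite (@eq_cintegral _ _ _ _ _ _ (fun w => a * (H w * g (Y w)))); last first.
  by move=> w _; rewrite mulrCA.
rewrite !cintegralZ// ?t 1?mulrCA//; first exact: bounded_measurable_comp.
by apply: bounded_measurableM => //; exact: bounded_measurable_comp.
Qed.

Let transfers_sum I (r : seq I) (g : I -> R -> R[i]) :
  (forall i, bounded_measurable (g i)) -> (forall i, transfers (g i)) ->
  transfers (fun y => \sum_(i <- r) g i y).
Proof.
move=> mg tg; elim: r => [|i r IH].
  rewrite /transfers (@eq_cintegral _ _ _ _ _ _ (fun=> 0)); last first.
    by move=> w _; rewrite big_nil mulr0.
  rewrite (@eq_cintegral _ _ _ _ _ _ (fun=> 0)); last by move=> w _; rewrite big_nil.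
  by rewrite cintegral_cst// mul0r mulr0.
rewrite (_ : (fun y => _) = fun y => g i y + \sum_(j <- r) g j y); last first.
  by apply/funext => y; rewrite big_cons.
by apply: transfersD => //; exact: bounded_measurable_sum.
Qed.

(** The average [s m] of the indicators of the m + 1 level sets of [u] is within 1 / (m + 1) of [u].
    It transfers by linearity, and bounded convergence passes the identity to [u]. *)
Let transfers_unit (u : R -> R) : measurable_fun setT u ->
  (forall y, 0 <= u y <= 1) -> transfers (fun y => (u y)%:C).
Proof.
move=> mu u01.
pose B m j := [set y | j.+1%:R <= m.+1%:R * u y].
have mB m j : measurable (B m j).
  rewrite /B -[X in measurable X]setTI; apply: measurable_fun_le => //.
  by apply: measurable_funM.
pose s (m : nat) (y : R) : R[i] :=
  \sum_(j < m.+1) (m.+1%:R^-1)%:C * (\1_(B m j) y)%:C.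
have msj m j : bounded_measurable (fun y => (m.+1%:R^-1)%:C * (\1_(B m j) y : R)%:C : R[i]).
  by apply: bounded_measurableM;
    [exact: bounded_measurable_cst|exact: bounded_measurable_indic].
have ms m : bounded_measurable (s m) by apply: bounded_measurable_sum.
have ts m : transfers (s m).
  apply: transfers_sum => // j; apply: transfersZ; last exact: HYc.
  exact: bounded_measurable_indic.
have sE m y : s m y = (m.+1%:R^-1 * \sum_(j < m.+1) (j.+1%:R <= m.+1%:R * u y)%R%:R)%:C.
  rewrite /s -mulr_sumr rmorphM/= rmorph_sum/=; congr (_ * _).
  apply: eq_bigr => j _; rewrite indicE.
  suff -> : (y \in B m j) = (j.+1%:R <= m.+1%:R * u y) by [].
  by apply/idP/idP; rewrite inE.
have su m y : `|(u y)%:C - s m y| <= (m.+1%:R^-1)%:C.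
  rewrite sE -rmorphB/= normc_def /= expr0n/= addr0 sqrtr_sqr lecR.
  have m0 : 0 < m.+1%:R :> R by rewrite ltr0n.
  rewrite -(ler_pM2l m0) divff ?gt_eqF// -[X in X * _](ger0_norm (ltW m0)) -normrM.
  rewrite mulrBr mulVKf ?gt_eqF//; apply: layer_cake_error.
  by have /andP[u0 u1] := u01 y; rewrite mulr_ge0 ?ler0n//= -[leRHS]mulr1 ler_wpM2l.
have sto y : (s m y : C) @[m --> \oo] --> ((u y)%:C : C).
  apply/cvg_complexP.
  have h0 : (m.+1%:R^-1 : R) @[m --> \oo] --> (0 : R) by exact: cvg_harmonic.
  split; apply/cvgrPdist_lt => e e0; move/cvgrPdist_lt : h0 => /(_ e e0);
    apply: filterS => m; rewrite sub0r normrN ger0_norm ?invr_ge0 ?ler0n// => me;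
    apply: le_lt_trans me; rewrite -lecR; apply: le_trans (su m y);
    rewrite -?ReN -?ImN -?ReD -?ImD; [exact: norm_Re_le|exact: norm_Im_le].
have sb m y : `|s m y| <= 2%:C.
  rewrite -[s m y](subrK (u y)%:C) (le_trans (ler_normD _ _))//.
  rewrite (_ : 2%:C = 1%:C + 1%:C); last by rewrite -rmorphD.
  rewrite lerD//.
    rewrite distrC (le_trans (su m y))// lecR invf_le1 ?ltr0n// ler1n//.
  have /andP[u0 u1] := u01 y.
  by rewrite normc_def /= expr0n/= addr0 sqrtr_sqr lecR ger0_norm.
have [K HK] : exists K : R, forall w, `|H w| <= K%:C.
  case: mH => _ _ [K HK]; exists (K + K) => w; have [h1 h2] := HK w.
  by rewrite (le_trans (norm_le_ReIm _))// lecR lerD.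
have lim1 : (E (fun w => H w * s m (Y w)) : C) @[m --> \oo] -->
    (E (fun w => H w * (u (Y w))%:C) : C).
  apply: (@cintegral_bounded_cvg _ _ _ P setT measurableT PT set0 _ _ (K * 2)).
  - exact: measurable0.
  - exact: measure0.
  - by move=> m; apply: bounded_measurableM => //; exact: bounded_measurable_comp.
  - by move=> m w _ _; rewrite normrM rmorphM/= ler_pM.
  - by move=> w _ _; apply: cvgM; [exact: cvg_cst|exact: sto].
have lim2 : (E (fun w => s m (Y' w)) : C) @[m --> \oo] -->
    (E (fun w => (u (Y' w))%:C) : C).
  apply: (@cintegral_bounded_cvg _ _ _ P setT measurableT PT set0 _ _ 2).
  - exact: measurable0.
  - exact: measure0.
  - by move=> m; exact: bounded_measurable_comp.
  - by move=> m w _ _.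
  - by move=> w _ _; exact: sto.
have tsE : (fun m => E (fun w => H w * s m (Y w))) = (fun m => c * E (fun w => s m (Y' w))).
  by apply/funext => m; exact: ts.
have lim3 : (c * E (fun w => s m (Y' w)) : C) @[m --> \oo] -->
    (c * E (fun w => (u (Y' w))%:C) : C).
  by apply: cvgM; [exact: cvg_cst|exact: lim2].
rewrite tsE in lim1.
exact: (@cvg_unique C (@norm_hausdorff _ _) _ _ _ _ lim1 lim3).
Qed.

(** Measure-theoretic induction from indicators to bounded functions. It serves twice: for
    independence, with [H] the other factors and [c] their mean, and for stationarity, with [H] and
    [c] equal to 1 and [Y], [Y'] of the same law. *)
Lemma cintegral_transfer (g : R -> R[i]) : bounded_measurable g ->
  E (fun w => H w * g (Y w)) = c * E (fun w => g (Y' w)).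
Proof.
move=> [mr mi [K0 gK0]].
(* Strictly positive, so that the affine map from [-K, K] onto [0, 1] divides by a nonzero
   number. *)
pose K := `|K0| + 1.
have K_gt0 : 0 < K by rewrite ltr_pwDr.
have gK y : `|Re (g y)| <= K /\ `|Im (g y)| <= K.
  have le : K0 <= K by rewrite (le_trans (ler_norm _))// lerDl.
  by have [h1 h2] := gK0 y; split; exact: le_trans le.
have real (u : R -> R) : measurable_fun setT u -> (forall y, `|u y| <= K) ->
    bounded_measurable (fun y => (u y)%:C) /\ transfers (fun y => (u y)%:C).
  move=> mu uK; split; first exact: bounded_measurable_real uK.
  pose v y := (u y + K) / (K + K).
  have mv : measurable_fun setT v.
    by apply: measurable_funM => //; apply: measurable_funD.
  have v01 y : 0 <= v y <= 1.
    have := uK y; rewrite ler_norml => /andP[h1 h2].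
    have KK : 0 < K + K by rewrite addr_gt0.
    rewrite /v ler_pdivrMr// mul1r lerD2r h2 andbT divr_ge0 ?(ltW KK)//.
    by rewrite -lerBlDr sub0r.
  have bmv : bounded_measurable (fun y => (v y)%:C).
    apply: (@bounded_measurable_real _ _ _ _ 1) => // y.
    by have /andP[v0 v1] := v01 y; rewrite ger0_norm.
  (* The constant is written as a multiple of the indicator of [setT], so that [HYc] covers it. *)
  rewrite (_ : (fun y => _) = fun y => (K + K)%:C * (v y)%:C + (- K)%:C * (\1_setT y)%:C).
    apply: transfersD.
    - by apply: bounded_measurableM => //; exact: bounded_measurable_cst.
    - apply: bounded_measurableM; first exact: bounded_measurable_cst.
      exact: bounded_measurable_indic.
    - by apply: transfersZ => //; exact: transfers_unit.
    - apply: transfersZ; last exact: HYc.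
      exact: bounded_measurable_indic.
  apply/funext => y; rewrite -!rmorphM -rmorphD/= indicE in_setT mulr1 /v.
  by congr (_%:C); field; rewrite -mulr2n mulrn_eq0/= gt_eqF.
have [b1 t1] := real (Re \o g) mr (fun y => (gK y).1).
have [b2 t2] := real (Im \o g) mi (fun y => (gK y).2).
change (transfers g).
rewrite (_ : g = fun y => (Re (g y))%:C + 'i%C * (Im (g y))%:C); last first.
  by apply/funext => y; rewrite -complexE.
apply: transfersD => //; last exact: transfersZ.
by apply: bounded_measurableM => //; exact: bounded_measurable_cst.
Qed.

End Transfer.

Section Independence.
Context d (T : measurableType d) (R : realType) (P : probability T R).
Local Notation E := (cintegral P setT).

(** Independence is the product formula for indicators. The indicators are exchanged for the
    functions [g i] one index at a time, each time by [cintegral_transfer]. *)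
Lemma cintegral_prod_independent (n : nat) (Y : nat -> T -> R) :
  (forall i, measurable_fun setT (Y i)) -> mutually_independent P n Y ->
  forall g : nat -> R -> R[i], (forall i, bounded_measurable (g i)) ->
  E (fun w => \prod_(i < n) g i (Y i w)) = \prod_(i < n) E (fun w => g i (Y i w)).
Proof.
move=> mY indY.
have PT : (P setT < +oo)%E by rewrite probability_setT ltry.
have m1 (B : nat -> set R) i : (forall i, measurable (B i)) -> measurable (Y i @^-1` B i).
  by move=> mB; rewrite -[X in measurable X]setTI; exact: mY.
have start (B : nat -> set R) : (forall i, measurable (B i)) ->
    E (fun w => \prod_(i < n) (\1_(B i) (Y i w))%:C) =
    \prod_(i < n) E (fun w => (\1_(B i) (Y i w))%:C).
  move=> mB.
  transitivity (E (fun w => (\1_(\bigcap_(i in `I_n) (Y i @^-1` B i)) w)%:C)).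
    apply: eq_cintegral => w _; rewrite -rmorph_prod/= indicE; congr _%:C.
    have [h|h] := pselect ((\bigcap_(i in `I_n) (Y i @^-1` B i)) w).
      rewrite (mem_set h) big1// => i _; rewrite indicE mem_set//.
      exact: (h i (ltn_ord i)).
    rewrite (memNset h).
    have [i /negPn/eqP i0] : exists i : 'I_n, ~~ (\1_(B i) (Y i w) != 0 :> R).
      apply/not_existsP => h'; apply: h => i /= ilt.
      have /negP/negPn := h' (Ordinal ilt).
      by rewrite indicE/=; have [/set_mem//|_] := boolP (_ \in _); rewrite eqxx.
    by rewrite (bigD1 i)//= i0 mul0r.
  rewrite cintegral_indic//; last first.
    by apply: bigcap_measurableType => i _; exact: m1.
  have e i : E (fun w => (\1_(B i) (Y i w))%:C) = (fine (P (Y i @^-1` B i)))%:C.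
    rewrite -[in RHS](setIT (_ @^-1` _)) -cintegral_indic//; exact: m1.
  rewrite setIT; under [RHS]eq_bigr do rewrite e.
  rewrite -rmorph_prod/=; congr _%:C.
  transitivity (fine (\prod_(i < n) P (Y i @^-1` B i))%E).
    by congr fine; exact: indY.
  rewrite (eq_bigr (fun i : 'I_n => (fine (P (Y i @^-1` B i)))%:E)) ?prodEFin//.
  by move=> i _; rewrite fineK// fin_num_measure//; exact: m1.
(* The induction is on [r]: only the functions of index below [r] may fail to be indicators. *)
suff main r : forall g : nat -> R -> R[i], (forall i, bounded_measurable (g i)) ->
    (forall i, (r <= i)%N -> exists2 B, measurable B & g i = fun y => (\1_B y)%:C) ->
    E (fun w => \prod_(i < n) g i (Y i w)) = \prod_(i < n) E (fun w => g i (Y i w)).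
  move=> g mg; pose g' i := if (i < n)%N then g i else fun y => (\1_setT y)%:C.
  transitivity (E (fun w => \prod_(i < n) g' i (Y i w))).
    by apply: eq_cintegral => w _; apply: eq_bigr => i _; rewrite /g' ltn_ord.
  rewrite (main n).
  - by apply: eq_bigr => i _; rewrite /g' ltn_ord.
  - by move=> i; rewrite /g'; case: ifP => // _; exact: bounded_measurable_indic.
  - by move=> i; rewrite /g' leqNgt => /negbTE ->; exists setT.
elim: r => [|r IH] g mg Bg.
  have [B mB gB] : exists2 B : nat -> set R, forall i, measurable (B i) &
      forall i, g i = fun y => (\1_(B i) y)%:C.
    have /choice[B hB] : forall i, exists B, measurable B /\ g i = fun y => (\1_B y)%:C.
      by move=> i; have [B] := Bg i isT; exists B.
    by exists B => i; have [] := hB i.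
  have := start B mB.
  rewrite (@eq_cintegral _ _ _ _ _ _ (fun w => \prod_(i < n) g i (Y i w))); last first.
    by move=> w _; apply: eq_bigr => i _; rewrite gB.
  by move=> ->; apply: eq_bigr => i _; rewrite gB.
(* With an indicator at index [r] the induction hypothesis applies. Read for all [B], it is the
   hypothesis of [cintegral_transfer] for the variable [Y r]. *)
pose gB B i := if i == r then fun y => (\1_B y : R)%:C else g i.
have hB B : measurable B -> E (fun w => \prod_(i < n) gB B i (Y i w)) =
    \prod_(i < n) E (fun w => gB B i (Y i w)).
  move=> mB; apply: IH => i; rewrite /gB; case: eqP => [_|/eqP ir]; rewrite //.
  - exact: bounded_measurable_indic.
  - by move=> _; exists B.
  - by move=> ri; apply: Bg; rewrite ltn_neqAle eq_sym ir.
have [nr|rn] := leqP n r.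
  have := hB setT measurableT.
  rewrite (@eq_cintegral _ _ _ _ _ _ (fun w => \prod_(i < n) g i (Y i w))); last first.
    move=> w _; apply: eq_bigr => i _.
    by rewrite /gB ltn_eqF// (leq_trans (ltn_ord i)).
  move=> ->; apply: eq_bigr => i _.
  by rewrite /gB ltn_eqF// (leq_trans (ltn_ord i)).
pose k := Ordinal rn.
have gBk B (i : 'I_n) : i != k -> gB B i = g i.
  by rewrite -val_eqE /gB /= => /negbTE ->.
rewrite (bigD1 k)//= mulrC.
rewrite -(@cintegral_transfer _ _ _ _
  (fun w => \prod_(i < n | i != k) g i (Y i w)) (Y r) (Y r)) //.
- by apply: eq_cintegral => w _; rewrite (bigD1 k)//= mulrC.
- by apply: bounded_measurable_prod => i _; exact: bounded_measurable_comp.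
move=> B mB; have := hB B mB.
rewrite (bigD1 k)//= [X in _ = X * _ -> _](_ : _ = E (fun w => (\1_B (Y r w))%:C)); last first.
  by rewrite /gB eqxx.
rewrite mulrC (eq_bigr (fun i : 'I_n => E (fun w => g i (Y i w)))); last first.
  by move=> i /gBk ->.
move=> <-; apply: eq_cintegral => w _; rewrite [RHS](bigD1 k)//= [RHS]mulrC /gB eqxx.
by congr (_ * _); apply: eq_bigr => i /gBk; rewrite /gB => ->.
Qed.

End Independence.

(** * Riemann sums *)

Section RightRiemannSums.
Variable R : realType.
Local Notation C := (R[i] : numFieldType).
Local Notation Re := (@complex.Re R).
Local Notation Im := (@complex.Im R).

(** Sampling at right ends makes right-continuity sufficient: the right end of the cell containing x
    approaches x from above. The Riemann sum is the integral of a step function, which converges to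
    [f] off the endpoint b, and the step functions see [f] only at the nodes, where the bound is
    assumed. *)
Lemma riemann_right (f : R -> R[i]) (b K : R) : 0 < b ->
  (forall t, 0 <= t < b -> Re (f x) @[x --> t^'+] --> Re (f t)) ->
  (forall t, 0 <= t < b -> Im (f x) @[x --> t^'+] --> Im (f t)) ->
  (forall m i, (i <= m)%N -> `|f (i.+1%:R * (b / m.+1%:R))| <= K%:C) ->
  ((b / m.+1%:R)%:C * \sum_(i < m.+1) f (i.+1%:R * (b / m.+1%:R)) : C)
    @[m --> \oo] --> (cintegral lebesgue_measure `[0, b] f : C).
Proof.
move=> b0 fr fi fK.
pose h m : R := b / m.+1%:R.
have h0 m : 0 < h m by rewrite divr_gt0.
have mh m : m.+1%:R * h m = b by rewrite mulrC divfK ?pnatr_eq0.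
pose cell m i : set R := `[i%:R * h m, i.+1%:R * h m[%classic.
pose step m (x : R) : R[i] :=
  \sum_(i < m.+1) f (i.+1%:R * h m) * (\1_(cell m i) x)%:C.
have mcell m i : measurable (cell m i) by exact: measurable_itv.
have mterm m i :
    bounded_measurable (fun x : R => f (i.+1%:R * h m) * (\1_(cell m i) x : R)%:C).
  apply: bounded_measurableM; first exact: bounded_measurable_cst.
  exact: bounded_measurable_indic.
have mb : measurable (`[0, b] : set R)%classic by exact: measurable_itv.
have boo : (lebesgue_measure (`[0%R, b] : set R)%classic < +oo)%E.
  by rewrite lebesgue_measure_itv/= lte_fin b0 ltry.
have int_step m : cintegral lebesgue_measure `[0, b] (step m) =
    (h m)%:C * \sum_(i < m.+1) f (i.+1%:R * h m).
  rewrite cintegral_sum//; last by move=> i _; exact: mterm.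
  rewrite mulr_sumr; apply: eq_bigr => i _.
  rewrite cintegralZ//; last exact: (bounded_measurable_indic _ (mcell m i)).
  rewrite cintegral_indic//; last exact: mcell.
  rewrite mulrC; congr (_ * _); congr _%:C.
  have -> : cell m i `&` `[0, b] = cell m i.
    apply/setIidPl => x; rewrite /cell /= !in_itv/= => /andP[x1 x2].
    apply/andP; split; first by rewrite (le_trans _ x1)// mulr_ge0// ltW.
    by rewrite -(mh m) (le_trans (ltW x2))// ler_wpM2r ?(ltW (h0 m))// ler_nat.
  have e : lebesgue_measure (cell m i) = (h m)%:E.
    rewrite lebesgue_measure_itv/= lte_fin ltr_pM2r// ltr_nat ltnSn -EFinB.
    by congr _%:E; rewrite -natr1; ring.
  exact: (congr1 fine e).
have stepE m x : 0 <= x < b -> step m x = f ((Num.truncn (x / h m)).+1%:R * h m).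
  move=> /andP[x0 xb].
  have xh0 : 0 <= x / h m by rewrite divr_ge0// ltW.
  have cellE i : \1_(cell m i) x = (i == Num.truncn (x / h m))%:R :> R.
    rewrite indicE; congr (_%:R); rewrite eq_sym truncn_eq// ler_pdivlMr// ltr_pdivrMr//.
    by apply: congr1; apply/idP/idP; rewrite inE /cell /= in_itv.
  have lt : (Num.truncn (x / h m) < m.+1)%N.
    by rewrite truncn_lt_nat// ltr_pdivrMr// mh.
  rewrite /step (bigD1 (Ordinal lt))//= cellE eqxx mulr1 big1 ?addr0// => i.
  by rewrite -val_eqE/= cellE => /negbTE ->; rewrite mulr0.
(* The strict inequality matters: a limit at [x^'+] ignores the value at x itself. It holds because
   the cells are closed on the left and open on the right. *)
have cvg_node x : 0 <= x < b ->
    (forall m, x < (Num.truncn (x / h m)).+1%:R * h m) /\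
    ((Num.truncn (x / h m)).+1%:R * h m @[m --> \oo] --> x).
  move=> /andP[x0 xb].
  have B m : x < (Num.truncn (x / h m)).+1%:R * h m <= x + h m.
    have /truncn_itv/andP[t1 t2] : 0 <= x / h m by rewrite divr_ge0// ltW.
    rewrite -ltr_pdivrMr// t2 /= -natr1 mulrDl mul1r lerD2r.
    by rewrite -ler_pdivlMr.
  split=> [m|]; first by have /andP[] := B m.
  apply: (@squeeze_cvgr _ _ _ _ (fun=> x) (fun m => x + h m)).
  - by apply: nearW => m; have /andP[/ltW -> ->] := B m.
  - exact: cvg_cst.
  - rewrite -[X in _ --> X]addr0; apply: cvgD; first exact: cvg_cst.
    rewrite -[X in _ --> X](mulr0 b); apply: cvgM; first exact: cvg_cst.
    exact: cvg_harmonic.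
have -> : (fun m => (b / m.+1%:R)%:C * \sum_(i < m.+1) f (i.+1%:R * (b / m.+1%:R))) =
    (fun m => cintegral lebesgue_measure `[0, b] (step m)).
  by apply/funext => m; rewrite int_step.
(* The half-open cells leave out b, which is discarded as a null set. *)
have bset1 x : (`[0, b]%classic : set R) x -> ~ [set b] x -> 0 <= x < b.
  by rewrite /= in_itv/= => /andP[-> xb] /eqP nxb; rewrite lt_neqAle nxb.
apply: (@cintegral_bounded_cvg _ _ R lebesgue_measure _ mb boo [set b] step f K).
- exact: measurable_set1.
- exact: lebesgue_measure_set1.
- by move=> m; apply: bounded_measurable_sum => i _; exact: mterm.
- move=> m x x0b xb; have xlt := bset1 _ x0b xb; rewrite stepE//.
  apply: fK; move/andP : xlt => [x0 xltb].
  have xh0 : 0 <= x / h m by rewrite divr_ge0// ltW.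
  by rewrite -ltnS truncn_lt_nat// ltr_pdivrMr// mh.
- move=> x x0b xb; have xlt := bset1 _ x0b xb.
  have nodes := cvg_node x xlt.
  apply/cvg_complexP; split.
    have -> : (fun m => Re (step m x)) =
        (fun m => Re (f ((Num.truncn (x / h m)).+1%:R * h m))).
      by apply/funext => m; rewrite stepE.
    by move/cvg_at_rightP : (fr x xlt); apply.
  have -> : (fun m => Im (step m x)) =
      (fun m => Im (f ((Num.truncn (x / h m)).+1%:R * h m))).
    by apply/funext => m; rewrite stepE.
  by move/cvg_at_rightP : (fi x xlt); apply.
Qed.

End RightRiemannSums.

(** * A multinomial expansion *)

Section Multinomial.
Variable F : numFieldType.

(** The exponential generating series exp (x X), truncated after degree n; the truncation leaves the
    coefficients of a product up to degree n intact. *)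
Let texp (n : nat) (x : F) : {poly F} := \poly_(j < n.+1) ((j`!%:R)^-1 * x ^+ j).

Let coef_prod_texp n m (z : nat -> F) j : (j <= n)%N ->
  (\prod_(i < m) texp n (z i))`_j = (j`!%:R)^-1 * (\sum_(i < m) z i) ^+ j.
Proof.
elim: m j => [|m IH] j jn.
  rewrite !big_ord0 coef1 expr0n; case: j jn => [|j] _ /=.
    by rewrite fact0 invr1 mulr1.
  by rewrite mulr0.
rewrite !big_ord_recr /= coefM addrC exprDn mulr_sumr; apply: eq_bigr => l _.
have lj : (l <= j)%N by rewrite -ltnS.
rewrite IH ?(leq_trans lj)// coef_poly ltnS (leq_trans (leq_subr _ _))//.
have f0 k : k`!%:R != 0 :> F by rewrite pnatr_eq0 -lt0n fact_gt0.
rewrite -mulr_natr -(bin_fact lj) !natrM; field.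
by rewrite !f0 /= pnatr_eq0 -lt0n bin_gt0 lj.
Qed.

(** The coefficient of X^n in the product of the exp (z_i X) is computed twice: through the
    exponential of the sum, and by distributing the product over the choice of one degree [k i] in
    each factor. *)
Lemma multinomial_factorial (m n : nat) (z : nat -> F) :
  (n`!%:R)^-1 * (\sum_(i < m) z i) ^+ n =
  \sum_(k : {ffun 'I_m -> 'I_n.+1} | (\sum_i k i == n)%N)
    \prod_(i < m) (((k i)`!%:R)^-1 * z i ^+ k i).
Proof.
rewrite -(@coef_prod_texp n)//; under eq_bigr do rewrite /texp poly_def.
rewrite bigA_distr_bigA coef_sum [RHS]big_mkcond; apply: eq_bigr => k _.
rewrite scaler_prod coefZ.
have -> : \prod_(i < m) 'X^(k i) = 'X^(\sum_i k i)%N :> {poly F}.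
  by rewrite -prodrXr.
by rewrite coefXn eq_sym; case: eqP => _; rewrite ?mulr1 ?mulr0.
Qed.

End Multinomial.

(** * Lévy processes *)

Lemma abel_summation (R : comPzRingType) (a : nat -> R) (x : nat -> R) (m : nat) :
  x 0%N = 0 ->
  \sum_(i < m) (\sum_(j < m) a j - \sum_(j < i) a j) * (x i.+1 - x i) =
  \sum_(i < m) a i * x i.+1.
Proof.
move=> x0; elim: m => [|m IH]; first by rewrite !big_ord0.
rewrite (eq_bigr (fun i : 'I_m.+1 =>
  (\sum_(j < m) a j - \sum_(j < i) a j) * (x i.+1 - x i) +
  a m * (x i.+1 - x i))); last first.
  by move=> i _; rewrite big_ord_recr/=; ring.
rewrite big_split/= -mulr_sumr big_ord_recr/= subrr mul0r addr0 IH [RHS]big_ord_recr/=.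
congr (_ + _ * _).
by rewrite -(big_mkord xpredT (fun i => x i.+1 - x i)) telescope_sumr// x0 subr0.
Qed.

Section LevyMoments.
Context (R : realType) d (T : measurableType d) (P : probability T R).
Variables (X : R -> T -> R) (Phi : R -> R[i]).
Hypotheses (levyX : levy_process P X) (PX0 : (0 < P [set w | X 0%R w = 0%R])%E)
  (charX : characteristic_exponent P X Phi).
Local Notation E := (cintegral P setT).
Local Notation A := [set w | X 0 w = 0].

Lemma levy_measurable t : 0 <= t -> measurable_fun setT (X t).
Proof. by case: levyX => mX _ _ _; exact: mX. Qed.

Lemma levy_start_measurable : measurable A.
Proof.
rewrite (_ : A = setT `&` X 0 @^-1` [set 0]); last by rewrite setTI.
by apply: (levy_measurable (lexx 0)) => //; exact: measurable_set1.
Qed.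

Lemma levy_start_fine_neq0 : (fine (P A))%:C != 0 :> R[i].
Proof.
rewrite -[X in _ != X](rmorph0 (real_complex R)) (inj_eq (@complexI R)).
by rewrite gt_eqF// fine_gt0// PX0 /= ltey_eq fin_num_measure//; exact: levy_start_measurable.
Qed.

Lemma increments_measurable (t : nat -> R) i : (forall j, 0 <= t j) ->
  measurable_fun setT (increments X t i).
Proof.
move=> t0; case: i => [|i] /=; first exact: levy_measurable.
by apply: measurable_funB; exact: levy_measurable.
Qed.

Lemma cond_expectationE f :
  cond_expectation P A f =
  ((fine (P A))%:C)^-1 * E (fun w => (\1_A w)%:C * f w).
Proof. by rewrite /cond_expectation fmorphV cintegral_mkcond. Qed.

(** [characteristic_exponent] is conditional on X_0 = 0, while this mean is not. Stationarity
    reduces to the increment from time 0, which is independent of X_0, and on the event X_0 = 0 it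
    equals X_t. *)
Lemma levy_increment_charfun s t y : 0 <= s -> 0 <= t ->
  E (fun w => cexp ('i%C * (y * (X (s + t) w - X s w))%:C)) =
  cexp (- (t%:C * Phi y)).
Proof.
move=> s0 t0; have st0 : 0 <= s + t by rewrite addr_ge0.
have PT : (P setT < +oo)%E by rewrite probability_setT ltry.
have mXst : measurable_fun setT (X (s + t) \- X s).
  by apply: measurable_funB; exact: levy_measurable.
have mX0t : measurable_fun setT (X t \- X 0).
  by apply: measurable_funB; exact: levy_measurable.
pose g x := cexp ('i%C * (y * x)%:C) : R[i].
have mg : bounded_measurable g.
  by apply: bounded_measurable_cexp_i; apply: measurable_funM.
have -> : E (fun w => g (X (s + t) w - X s w)) = E (fun w => g (X t w - X 0 w)).
  have := @cintegral_transfer _ _ _ P (fun=> 1) _ _ 1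
    (@bounded_measurable_cst _ T R 1) mXst mX0t _ g mg.
  rewrite mul1r => <-.
    by apply: eq_cintegral => w _; rewrite mul1r.
  move=> B mB; rewrite mul1r.
  have e (Y : T -> R) : measurable_fun setT Y ->
      E (fun w => (\1_B (Y w))%:C) = (fine (P (Y @^-1` B)))%:C.
    move=> mY; have mYB : measurable (Y @^-1` B).
      by rewrite -[X in measurable X]setTI; exact: mY.
    by rewrite -[in RHS](setIT (Y @^-1` B)) -cintegral_indic.
  under eq_cintegral do rewrite mul1r.
  rewrite !e//; congr (_%:C); congr fine.
  by case: levyX => _ _ stat _; exact: stat.
rewrite -(charX y t0) cond_expectationE.
apply: (mulfI levy_start_fine_neq0); rewrite mulrA divff ?levy_start_fine_neq0// mul1r.
(* Along these times the first two members of [increments X u] are X_0 and X_t - X_0. *)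
pose u (i : nat) : R := if i is 0%N then 0 else t.
have u0 j : 0 <= u j by case: j.
have und : nondecreasing_seq u by move=> [|i] [|j].
have indep : mutually_independent P 2 (increments X u).
  by case: levyX => _ ind _ _; apply: ind; [exact: u0|exact: und].
pose G (i : nat) := if i is 0%N then (fun x => (\1_[set (0 : R)] x)%:C : R[i]) else g.
have mG i : bounded_measurable (G i).
  by case: i => //=; exact: bounded_measurable_indic.
transitivity (E (fun w => \prod_(i < 2) G i (increments X u i w))).
  rewrite cintegral_prod_independent => [|i||//]; [|exact: increments_measurable|exact: indep].
  rewrite !big_ord_recl big_ord0 mulr1 /=; congr (_ * _).
  rewrite -[in LHS](setIT A) -cintegral_indic//; last exact: levy_start_measurable.
apply: eq_cintegral => w _; rewrite !big_ord_recl big_ord0 mulr1 /=.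
have [w0|w0] := pselect (X 0 w = 0); last by rewrite !indic0C// !mul0r.
by rewrite !indic1C// !mul1r /g w0 subr0.
Qed.

(** On the event X_0 = 0 Abel summation has no boundary term, and the increment over cell i receives
    as coefficient the tail sum k_i + ... + k_(m-1). *)
Lemma levy_moment (alpha h : R) (m : nat) (k : nat -> nat) : 0 <= h ->
  cond_expectation P A
    (fun w => \prod_(i < m) cexp ('i%C * (alpha * X (i.+1%:R * h) w)%:C) ^+ k i) =
  \prod_(i < m) cexp (- (h%:C *
    Phi (alpha * ((\sum_(j < m) k j)%N%:R - (\sum_(j < i) k j)%N%:R)))).
Proof.
move=> h0.
pose S (i : nat) : R := (\sum_(j < m) k j)%N%:R - (\sum_(j < i) k j)%N%:R.
pose u (i : nat) : R := i%:R * h.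
have u0 j : 0 <= u j by rewrite mulr_ge0.
have und : nondecreasing_seq u by move=> i j ij; rewrite ler_wpM2r// ler_nat.
have indep : mutually_independent P m.+1 (increments X u).
  by case: levyX => _ ind _ _; apply: ind; [exact: u0|exact: und].
(* The conditioning event becomes one more factor, at index 0. Hence there are m + 1 independent
   variables, and cell i sits at index i + 1. *)
pose G (i : nat) : R -> R[i] := if i is i.+1 then fun x => cexp ('i%C * (alpha * S i * x)%:C)
  else fun x => (\1_[set (0 : R)] x)%:C.
have mG i : bounded_measurable (G i).
  case: i => [|i] /=; first exact: bounded_measurable_indic.
  by apply: bounded_measurable_cexp_i; apply: measurable_funM.
have uE0 : u 0%N = 0 by rewrite /u mul0r.
rewrite cond_expectationE; apply: (mulfI levy_start_fine_neq0).
rewrite mulrA divff ?levy_start_fine_neq0// mul1r.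
transitivity (E (fun w => \prod_(i < m.+1) G i (increments X u i w))).
  apply: eq_cintegral => w _; rewrite big_ord_recl /= uE0.
  have [w0|w0] := pselect (X 0 w = 0); last by rewrite !indic0C// !mul0r.
  rewrite !indic1C// !mul1r; under eq_bigr do rewrite -cexpMn.
  rewrite -!cexp_sum; congr cexp.
  have := @abel_summation R (fun i => (k i)%:R) (fun i => X (u i) w) m.
  rewrite uE0 => /(_ w0) abel.
  transitivity ('i%C * (alpha * \sum_(i < m) (k i)%:R * X (u i.+1) w)%:C).
    rewrite mulr_sumr rmorph_sum mulr_sumr; apply: eq_bigr => i _ /=.
    by rewrite -mulrnAr -rmorphMn/= -mulrnAr -[X _ w *+ _]mulr_natl.
  rewrite -abel mulr_sumr rmorph_sum mulr_sumr; apply: eq_bigr => i _ /=.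
  by rewrite /S add0n !natr_sum mulrA.
rewrite cintegral_prod_independent => [|i||//]; [|exact: increments_measurable|exact: indep].
rewrite big_ord_recl /= uE0; congr (_ * _).
  rewrite -[in RHS](setIT A) -cintegral_indic//; last exact: levy_start_measurable.
apply: eq_bigr => i _; rewrite -/(S i) -(@levy_increment_charfun (u i) h)//.
have -> : u i + h = u i.+1 by rewrite /u -natr1 mulrDl mul1r.
by apply: eq_cintegral => w _; rewrite /= add0n.
Qed.

End LevyMoments.

(** * Poisson processes *)

Section PoissonPaths.
Context (R : realType) d (T : measurableType d) (Q : probability T R).
Variable N : R -> T -> nat.
Hypotheses (poissonN : standard_poisson_process Q N)
  (QN0 : (0 < Q [set w | N 0%R w = 0%N])%E).
Local Notation A := [set w | N 0 w = 0%N].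

Let X t w : R := (N t w)%:R.

Let levyX : levy_process Q X. Proof. by case: poissonN. Qed.

Let mX t : 0 <= t -> measurable_fun setT (X t).
Proof. by case: levyX => mX _ _ _; exact: mX. Qed.

Let mincr s t (B : set R) : 0 <= s -> 0 <= t -> measurable B ->
  measurable ((X t \- X s) @^-1` B).
Proof.
move=> s0 t0 mB; rewrite -[X in measurable X]setTI.
by apply: measurable_funB => //; exact: mX.
Qed.

Lemma poisson_jump_preimage s t k :
  [set w | N t w = (N s w + k)%N] = (X t \- X s) @^-1` [set k%:R].
Proof.
apply/seteqP; split=> w /=; rewrite /X.
  by move=> ->; rewrite natrD addrC addKr.
by move/eqP; rewrite subr_eq -natrD eqr_nat addnC => /eqP.
Qed.

Lemma poisson_jump_measurable s t k : 0 <= s -> 0 <= t ->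
  measurable [set w | N t w = (N s w + k)%N].
Proof. by move=> s0 t0; rewrite poisson_jump_preimage; exact: mincr. Qed.

Lemma poisson_start_preimage : A = X 0 @^-1` [set 0].
Proof.
apply/seteqP; split=> w /=; rewrite /X; first by move=> ->.
by move/eqP; rewrite pnatr_eq0 => /eqP.
Qed.

Lemma poisson_start_measurable : measurable A.
Proof.
by rewrite poisson_start_preimage -[X in measurable X]setTI; exact: mX.
Qed.

(** Monotone paths are not part of the definition of N. They are recovered, for a fixed pair of
    times, from the Poisson weights: the jumps k = 0, 1, 2, ... already have total probability 1. *)
Lemma poisson_decreasing_null s t : 0 <= s -> s < t ->
  measurable [set w | (N t w < N s w)%N] /\ Q [set w | (N t w < N s w)%N] = 0%E.
Proof.
move=> s0 st; have t0 : 0 <= t by rewrite (le_trans s0)// ltW.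
pose J k := [set w | N t w = (N s w + k)%N].
have mJ k : measurable (J k) by exact: poisson_jump_measurable.
have -> : [set w | (N t w < N s w)%N] = ~` (\bigcup_k J k).
  apply/seteqP; split=> w /=.
    by move=> lt [k _]; rewrite /J/= => e; move: lt; rewrite e ltnNge leq_addr.
  rewrite ltnNge; apply: contra_notN => le.
  by exists (N t w - N s w)%N => //; rewrite /J/= subnKC.
have mU : measurable (\bigcup_k J k) by exact: bigcupT_measurable.
split; first exact: measurableC.
rewrite probability_setC// (_ : Q _ = 1%E) ?subee//.
rewrite measure_bigcup//; last first.
  apply/trivIsetP => i j _ _ ij; apply/seteqP; split=> // w [].
  by rewrite /J/= => -> /addnI e; move: ij; rewrite e eqxx.
rewrite (eq_eseriesr (fun k _ => poissonN.2 s t k s0 st)).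
have : poisson_prob (t - s) 0 setT = 1%E := probability_setT _.
rewrite /poisson_prob subr_gt0 st => <-.
rewrite nneseries_esum ?set_mem_set// => k _; rewrite lee_fin; exact: poisson_pmf_ge0.
Qed.

Variable delta : R.
Hypothesis delta_gt0 : 0 < delta.
Let node (i : nat) : R := i%:R * delta.
Let node_ge0 i : 0 <= node i. Proof. by rewrite mulr_ge0// ltW. Qed.

Definition poisson_path (m : nat) (k : nat -> nat) : set T :=
  \bigcap_(i in `I_m) [set w | N (i.+1%:R * delta) w = (N (i%:R * delta) w + k i)%N].

Lemma poisson_path_measurable m k : measurable (poisson_path m k).
Proof.
by apply: bigcap_measurableType => i _; apply: poisson_jump_measurable; exact: node_ge0.
Qed.

Lemma poisson_path_prob m k :
  fine (Q (poisson_path m k `&` A)) =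
  fine (Q A) * \prod_(i < m) poisson_pmf delta (k i).
Proof.
(* As for X, index 0 of the increments carries the event N_0 = 0. *)
pose B (i : nat) : set R := if i is i.+1 then [set (k i)%:R] else [set 0].
have mB i : measurable (B i) by case: i => [|i]; exact: measurable_set1.
have incrE i : increments X node i @^-1` B i =
    if i is i.+1 then [set w | N (i.+1%:R * delta) w = (N (i%:R * delta) w + k i)%N] else A.
  case: i => [|i] /=; first by rewrite /node mul0r poisson_start_preimage.
  by rewrite poisson_jump_preimage.
have -> : poisson_path m k `&` A =
    \bigcap_(i in `I_m.+1) (increments X node i @^-1` B i).
  apply/seteqP; split=> w.
    move=> [pw Aw] i im; rewrite incrE; case: i im => [//|i im].
    exact: pw.
  move=> h; split; last by have := h 0%N isT; rewrite (incrE 0%N).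
  by move=> i /= im; have := h i.+1 im; rewrite (incrE i.+1)//=.
case: levyX => _ ind _ _; rewrite (ind m.+1 node) => //; first last.
  by move=> i j ij; rewrite /node ler_wpM2r ?ler_nat// ltW.
rewrite big_ord_recl incrE.
rewrite (eq_bigr (fun i : 'I_m => (poisson_pmf delta (k i))%:E)); last first.
  move=> i _; have lt : node i < node i.+1 by rewrite ltr_pM2r// ltr_nat.
  rewrite (incrE (bump 0 i)) /bump/= add0n (poissonN.2 _ _ _ (node_ge0 i) lt).
  by rewrite /node -mulrBl -natrB// subSnn mul1r.
by rewrite prodEFin -(fineK (fin_num_measure Q _ poisson_start_measurable)) -EFinM.
Qed.

Lemma poisson_path_value m k w : A w -> poisson_path m k w ->
  forall i, (i <= m)%N -> N (i%:R * delta) w = (\sum_(j < i) k j)%N.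
Proof.
move=> Aw pw; elim=> [|i IH] im; first by rewrite mul0r big_ord0.
by rewrite big_ord_recr/= -IH ?(ltnW im)//; exact: pw.
Qed.

(** Extension by 0 to all indices, so that partial sums and [poisson_path], which expect a sequence,
    accept a tuple. *)
Definition nat_of_ffun m n (k : {ffun 'I_m -> 'I_n.+1}) (i : nat) : nat :=
  oapp (fun j => nat_of_ord (k j)) 0%N (insub i).

Lemma nat_of_ffunE m n (k : {ffun 'I_m -> 'I_n.+1}) (i : 'I_m) :
  nat_of_ffun k i = k i.
Proof. by rewrite /nat_of_ffun valK. Qed.

(** A path nondecreasing along the nodes lies in the event of exactly one tuple, that of its jumps,
    and this tuple has sum n exactly when the path ends at n. So at most one summand survives. *)
Lemma poisson_path_decomposition m n (G : nat -> R[i]) w : A w ->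
  (forall i, (i < m)%N -> (N (i%:R * delta) w <= N (i.+1%:R * delta) w)%N) ->
  (\prod_(i < m) G (N (i%:R * delta) w)) *
    (\1_[set w' | N (m%:R * delta) w' = n] w)%:C =
  \sum_(k : {ffun 'I_m -> 'I_n.+1} | (\sum_i k i == n)%N)
    (\prod_(i < m) G (\sum_(j < i) nat_of_ffun k j)%N) *
    (\1_(poisson_path m (nat_of_ffun k)) w)%:C.
Proof.
move=> Aw mono.
have sumE (k : {ffun 'I_m -> 'I_n.+1}) :
    (\sum_(j < m) nat_of_ffun k j = \sum_i k i)%N.
  by apply: eq_bigr => i _; rewrite nat_of_ffunE.
have [Nn|Nn] := pselect (N (m%:R * delta) w = n); last first.
  rewrite indic0C// mulr0 big1// => k /eqP kn; rewrite indic0C ?mulr0// => pw.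
  by apply: Nn; rewrite (poisson_path_value Aw pw)// sumE.
rewrite indic1C// mulr1.
pose diff i := (N (i.+1%:R * delta) w - N (i%:R * delta) w)%N.
have diff_sum i : (i <= m)%N -> (\sum_(j < i) diff j)%N = N (i%:R * delta) w.
  elim: i => [|i IH] im; first by rewrite big_ord0 mul0r Aw.
  by rewrite big_ord_recr/= IH ?(ltnW im)// /diff subnKC// mono.
(* [inord] does not truncate here: every jump is at most the total n. *)
pose k0 : {ffun 'I_m -> 'I_n.+1} := [ffun i : 'I_m => inord (diff i)].
have k0E (i : 'I_m) : nat_of_ffun k0 i = diff i.
  rewrite nat_of_ffunE ffunE inordK// ltnS -Nn -(diff_sum _ (leqnn m)).
  by rewrite (bigD1 i)//= leq_addr.
have k0S i : (i <= m)%N -> (\sum_(j < i) nat_of_ffun k0 j)%N = N (i%:R * delta) w.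
  move=> im; rewrite -diff_sum//; apply: eq_bigr => j _.
  exact: (k0E (widen_ord im j)).
have pw0 : poisson_path m (nat_of_ffun k0) w.
  move=> i /= im; rewrite (k0E (Ordinal im)) /diff/= subnKC//; exact: mono.
rewrite (bigD1 k0)/=; last by rewrite -sumE k0S// Nn.
rewrite indic1C// mulr1 [X in _ = _ + X]big1 ?addr0.
  by apply: eq_bigr => i _; rewrite k0S// ltnW.
move=> k /andP[_ kk0]; rewrite indic0C ?mulr0// => pw.
move/eqP: kk0; apply; apply/ffunP => i; apply: val_inj => /=.
have := pw i (ltn_ord i); rewrite /= => e.
by rewrite -nat_of_ffunE -(nat_of_ffunE k0) k0E /diff e addKn.
Qed.

(** The integrand is kept as a combination of path events, hence measurable whatever the paths do.
    It is identified with a functional of N only on paths that are nondecreasing along the nodes. *)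
Lemma poisson_functional m n (G : nat -> R[i]) :
  cond_expectation Q A (fun w =>
    \sum_(k : {ffun 'I_m -> 'I_n.+1} | (\sum_i k i == n)%N)
      (\prod_(i < m) G (\sum_(j < i) nat_of_ffun k j)%N) *
      (\1_(poisson_path m (nat_of_ffun k)) w)%:C) =
  \sum_(k : {ffun 'I_m -> 'I_n.+1} | (\sum_i k i == n)%N)
    \prod_(i < m) ((poisson_pmf delta (k i))%:C *
      G (\sum_(j < i) nat_of_ffun k j)%N).
Proof.
have mA := poisson_start_measurable.
have Qoo : (Q A < +oo)%E by rewrite ltey_eq fin_num_measure.
have QA : fine (Q A) != 0 by rewrite gt_eqF// fine_gt0// QN0.
rewrite /cond_expectation cintegral_sum//; last first.
  move=> k _; apply: bounded_measurableM; first exact: bounded_measurable_cst.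
  by apply: bounded_measurable_indic; exact: poisson_path_measurable.
rewrite mulr_sumr; apply: eq_bigr => k _.
have mp := @poisson_path_measurable m (nat_of_ffun k).
rewrite cintegralZ//; last exact: bounded_measurable_indic.
rewrite cintegral_indic// poisson_path_prob mulrCA -rmorphM mulKf//.
rewrite rmorph_prod mulrC -big_split/=; apply: eq_bigr => i _.
by rewrite nat_of_ffunE.
Qed.

End PoissonPaths.

(** * The discrete identity *)

Section CondExpectation.
Context (R : realType) d (T : measurableType d) (P : probability T R) (A : set T).
Hypothesis mA : measurable A.
Local Notation C := (R[i] : numFieldType).
Local Notation E := (cond_expectation P A).

Let PA : (P A < +oo)%E. Proof. by rewrite ltey_eq fin_num_measure. Qed.

Lemma cond_expectationZ (c : R[i]) f : bounded_measurable f ->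
  E (fun w => c * f w) = c * E f.
Proof. by move=> mf; rewrite /cond_expectation cintegralZ// mulrCA. Qed.

Lemma cond_expectation_sum I (r : seq I) (p : pred I) (F : I -> T -> R[i]) :
  (forall i, p i -> bounded_measurable (F i)) ->
  E (fun w => \sum_(i <- r | p i) F i w) = \sum_(i <- r | p i) E (F i).
Proof. by move=> mF; rewrite /cond_expectation cintegral_sum// mulr_sumr. Qed.

Lemma eq_cond_expectation f g : (forall w, A w -> f w = g w) -> E f = E g.
Proof. by move=> fg; rewrite /cond_expectation (eq_cintegral _ fg). Qed.

Lemma cond_expectation_bounded_cvg Z (f_ : nat -> T -> R[i]) f (K : R) :
  measurable Z -> P Z = 0%E ->
  (forall n, bounded_measurable (f_ n)) ->
  (forall n x, A x -> ~ Z x -> `|f_ n x| <= K%:C) ->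
  (forall x, A x -> ~ Z x -> (f_ n x : C) @[n --> \oo] --> (f x : C)) ->
  (E (f_ n) : C) @[n --> \oo] --> (E f : C).
Proof.
move=> mZ Z0 mf fK fl; apply: cvgM; first exact: cvg_cst.
exact: (cintegral_bounded_cvg mA PA mZ Z0 mf fK fl).
Qed.

End CondExpectation.

Section BoundedLimits.
Context (R : realType) d (T : measurableType d).
Local Notation C := (R[i] : numFieldType).
Local Notation Re := (@complex.Re R).
Local Notation Im := (@complex.Im R).

Lemma bounded_measurable_cvg (f_ : nat -> T -> R[i]) f (K : R) :
  (forall n, bounded_measurable (f_ n)) -> (forall n x, `|f_ n x| <= K%:C) ->
  (forall x, (f_ n x : C) @[n --> \oo] --> (f x : C)) ->
  bounded_measurable f.
Proof.
move=> mf fK fl.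
have lim_le (u : nat -> R) (l : R) : u n @[n --> \oo] --> l ->
    (forall n, `|u n| <= K) -> `|l| <= K.
  move=> /cvg_norm ul uK; rewrite -(cvg_lim _ ul)//.
  apply: limr_le; last exact: nearW.
  by apply/cvg_ex; exists (`|l|).
split.
- apply: (@measurable_fun_cvg _ _ _ setT (fun n => Re \o f_ n)).
    by move=> n; have [] := mf n.
  by move=> x _; have /cvg_complexP[] := fl x.
- apply: (@measurable_fun_cvg _ _ _ setT (fun n => Im \o f_ n)).
    by move=> n; have [] := mf n.
  by move=> x _; have /cvg_complexP[] := fl x.
exists K => x; have /cvg_complexP[fr fi] := fl x.
split; [apply: (lim_le _ _ fr)|apply: (lim_le _ _ fi)] => n; rewrite -lecR.
  exact: le_trans (norm_Re_le _) (fK n x).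
exact: le_trans (norm_Im_le _) (fK n x).
Qed.

(** The dominating constant that allows the exponential series and the expectation to be
    exchanged. *)
Lemma norm_exp_partial_sum (z : R[i]) (b : R) (m : nat) : `|z| <= b%:C ->
  `|\sum_(k < m) (k`!%:R)^-1 * z ^+ k| <= (expR b)%:C.
Proof.
move=> zb; have b0 : 0 <= b by rewrite -ler0c (le_trans _ zb).
apply: (le_trans (ler_norm_sum _ _ _)).
apply: (@le_trans _ _ ((series (exp_coeff b) m)%:C)).
  rewrite /series/= rmorph_sum/= big_mkord; apply: ler_sum => k _.
  rewrite normrM normrX complex_natrV rmorphM/= mulrC rmorphXn/=.
  apply: ler_pM => //.
    by rewrite lerXn2r// nnegrE// lecR.
  by rewrite norm_real_complex ger0_norm.
rewrite lecR; apply: nondecreasing_cvgn_le; last exact: is_cvg_series_exp_coeff.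
apply/nondecreasing_seqP => k; rewrite /series/= big_nat_recr//= lerDl.
exact: exp_coeff_ge0.
Qed.

End BoundedLimits.

Lemma poisson_pmfE (R : realType) (delta : R) k : 0 < delta ->
  poisson_pmf delta k = expR (- delta) * delta ^+ k * (k`!%:R)^-1.
Proof. by move=> d0; rewrite /poisson_pmf d0; ring. Qed.

Section DiscreteIdentity.
Context (R : realType) d (T : measurableType d) (P : probability T R).
Variables (X : R -> T -> R) (Phi : R -> R[i]).
Hypotheses (levyX : levy_process P X) (PX0 : (0 < P [set w | X 0%R w = 0%R])%E)
  (charX : characteristic_exponent P X Phi).
Local Notation A := [set w | X 0 w = 0].

(** Both sides are sums over the same tuples and agree term by term: the factorials and powers from
    the multinomial expansion form the Poisson weights, and [levy_moment] gives the factors with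
    [Phi]. *)
Lemma discrete_moment_identity (alpha lambda h : R) (m n : nat) :
  0 < lambda -> 0 < h ->
  (lambda ^+ n)%:C * (n`!%:R)^-1 * cond_expectation P A (fun w =>
    (h%:C * \sum_(i < m) cexp ('i%C * (alpha * X (i.+1%:R * h) w)%:C)) ^+ n) =
  cexp ((m%:R * (lambda * h))%:C) *
  \sum_(k : {ffun 'I_m -> 'I_n.+1} | (\sum_i k i == n)%N)
    \prod_(i < m) ((poisson_pmf (lambda * h) (k i))%:C *
      cexp (- (h%:C * Phi (alpha * (n%:R - (\sum_(j < i) nat_of_ffun k j)%N%:R))))).
Proof.
move=> l0 h0; have d0 : 0 < lambda * h by rewrite mulr_gt0.
have mA : measurable A by exact: (levy_start_measurable levyX).
pose z i w := cexp ('i%C * (alpha * X (i.+1%:R * h) w)%:C) : R[i].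
have mz i : bounded_measurable (z i).
  apply: bounded_measurable_cexp_i; apply: measurable_funM => //.
  by apply: (levy_measurable levyX); rewrite mulr_ge0// ltW.
have mpow (k : {ffun 'I_m -> 'I_n.+1}) :
    bounded_measurable (fun w => \prod_(i < m) z i w ^+ nat_of_ffun k i).
  by apply: bounded_measurable_prod => i _; exact: bounded_measurableX.
rewrite -cond_expectationZ//; last first.
  apply: bounded_measurableX; apply: bounded_measurableM.
    exact: bounded_measurable_cst.
  by apply: bounded_measurable_sum => i _; exact: mz.
transitivity (cond_expectation P A (fun w =>
    \sum_(k : {ffun 'I_m -> 'I_n.+1} | (\sum_i k i == n)%N)
    (((lambda * h) ^+ n)%:C * \prod_(i < m) ((k i)`!%:R)^-1) *
      \prod_(i < m) z i w ^+ nat_of_ffun k i)).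
  apply: eq_cond_expectation => w _.
  under [RHS]eq_bigr do rewrite -mulrA -big_split/=.
  rewrite -mulr_sumr.
  transitivity (((lambda * h) ^+ n)%:C * ((n`!%:R)^-1 * (\sum_(i < m) z i w) ^+ n)).
    rewrite -/(\sum_(i < m) z i w) !exprMn !rmorphM /= !rmorphXn/=; ring.
  rewrite (multinomial_factorial m n (fun i => z i w)); congr (_ * _).
  apply: eq_bigr => k _; apply: eq_bigr => i _.
  by rewrite nat_of_ffunE.
rewrite cond_expectation_sum//; last first.
  move=> k _; apply: bounded_measurableM; [exact: bounded_measurable_cst|exact: mpow].
rewrite mulr_sumr; apply: eq_bigr => k /eqP kn.
rewrite cond_expectationZ//.
rewrite (levy_moment levyX PX0 charX alpha m (nat_of_ffun k) (ltW h0)).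
have -> : (\sum_(j < m) nat_of_ffun k j)%N = n.
  by rewrite -[RHS]kn; apply: eq_bigr => i _; rewrite nat_of_ffunE.
rewrite [in RHS]big_split/= [RHS]mulrA; congr (_ * _).
(* The powers collect to exponent n because [k] has sum n, and the m factors exp (- lambda h) are
   cancelled by the exponential in front of the sum. *)
have -> : \prod_(i < m) (poisson_pmf (lambda * h) (k i))%:C =
    ((expR (- (lambda * h)) ^+ m)%:C * ((lambda * h) ^+ n)%:C) *
    \prod_(i < m) ((k i)`!%:R)^-1.
  rewrite (eq_bigr (fun i : 'I_m => (expR (- (lambda * h)))%:C *
      ((lambda * h) ^+ k i)%:C * ((k i)`!%:R)^-1)); last first.
    by move=> i _; rewrite poisson_pmfE// !rmorphM/= complex_natrV.
  rewrite !big_split/= prodr_const card_ord rmorphXn/=; congr (_ * _ * _).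
  by rewrite -rmorph_prod/= prodrXr kn.
rewrite [RHS]mulrA; congr (_ * _); rewrite mulrA cexp_real expRM_natl -!rmorphM/= -exprMn.
by rewrite expRxMexpNx_1 expr1n mul1r.
Qed.
End DiscreteIdentity.

(** * The limit of vanishing mesh *)

Section PathLimits.
Variable R : realType.
Local Notation C := (R[i] : numFieldType).
Local Notation Re := (@complex.Re R).
Local Notation Im := (@complex.Im R).

Lemma oscillatory_riemann_sum (f : R -> R) (alpha v : R) : 0 < v ->
  (forall t, 0 <= t -> f x @[x --> t^'+] --> f t) ->
  ((v / m.+1%:R)%:C *
    \sum_(i < m.+1) cexp ('i%C * (alpha * f (i.+1%:R * (v / m.+1%:R)))%:C) : C)
    @[m --> \oo] -->
  (cintegral lebesgue_measure `[0, v] (fun u => cexp ('i%C * (alpha * f u)%:C)) : C).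
Proof.
move=> v0 fr.
have afr t : 0 <= t -> (alpha * f x) @[x --> t^'+] --> alpha * f t.
  by move=> t0; apply: cvgM; [exact: cvg_cst|exact: fr].
apply: (@riemann_right _ (fun u => cexp ('i%C * (alpha * f u)%:C)) _ 1 v0).
- move=> t /andP[t0 _].
  have -> : (fun u => Re (cexp ('i%C * (alpha * f u)%:C))) = (fun u => cos (alpha * f u)).
    by apply/funext => u; rewrite cexp_i.
  by rewrite cexp_i; apply: continuous_cvg; [exact: continuous_cos|exact: afr].
- move=> t /andP[t0 _].
  have -> : (fun u => Im (cexp ('i%C * (alpha * f u)%:C))) = (fun u => sin (alpha * f u)).
    by apply/funext => u; rewrite cexp_i.
  by rewrite cexp_i; apply: continuous_cvg; [exact: continuous_sin|exact: afr].
- by move=> m i _; rewrite norm_cexp_i.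
Qed.

Lemma norm_oscillatory_sum (x : nat -> R) (v : R) (m : nat) : 0 < v ->
  `|(v / m.+1%:R)%:C * \sum_(i < m.+1) cexp ('i%C * (x i)%:C)| <= v%:C.
Proof.
move=> v0; have h0 : 0 <= v / m.+1%:R by rewrite divr_ge0// ltW.
rewrite normrM norm_real_complex (ger0_norm h0).
apply: (@le_trans _ _ ((v / m.+1%:R)%:C * m.+1%:R)).
  apply: ler_wpM2l; first by rewrite ler0c.
  apply: (le_trans (ler_norm_sum _ _ _)).
  by under eq_bigr do rewrite norm_cexp_i; rewrite sumr_const card_ord.
by rewrite -(rmorph_nat (real_complex R)) -rmorphM/= divfK ?pnatr_eq0.
Qed.

Section CountingPath.
Variables (nu : R -> nat) (g : nat -> R[i]) (c b : R) (n : nat).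
Hypotheses (c0 : 0 < c) (b0 : 0 < b) (nu0 : nu 0 = 0%N) (nub : nu b = n).
Hypothesis nu_right : forall t, 0 <= t -> (nu x)%:R @[x --> t^'+] --> ((nu t)%:R : R).
Local Notation node m i := (i%:R * (b / m.+1%:R)).
Hypothesis nu_mono : forall m i, (nu (node m i) <= nu (node m i.+1))%N.

Let node_last m : node m m.+1 = b.
Proof. by rewrite mulrC divfK// pnatr_eq0. Qed.

Let nu_le m i : (i <= m.+1)%N -> (nu (node m i) <= n)%N.
Proof.
move=> im; have mono j : (nu (node m i) <= nu (node m (i + j)%N))%N.
  by elim: j => [|j IH]; rewrite ?addn0// addnS (leq_trans IH).
by have := mono (m.+1 - i)%N; rewrite subnKC// node_last nub.
Qed.

(** The path stays in {0, ..., n} at the nodes, so a finite sum bounds [g] there although [g] itself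
    may be unbounded. *)
Let gbound := \sum_(l < n.+1) (`|Re (g l)| + `|Im (g l)|).

Let gb l : (l <= n)%N -> `|Re (g l)| + `|Im (g l)| <= gbound.
Proof.
rewrite -ltnS => ln; rewrite /gbound (bigD1 (Ordinal ln))//= lerDl.
by apply: sumr_ge0 => *; rewrite addr_ge0.
Qed.

(** The exponent is a Riemann sum at left ends. [riemann_right] treats right ends, and the
    difference telescopes to [err], which is of the order of the mesh. *)
Lemma counting_riemann_product :
  (\prod_(i < m.+1) cexp (- ((c * (b / m.+1%:R))%:C * g (nu (node m i)))) : C)
    @[m --> \oo] -->
  (cexp (- (c%:C * cintegral lebesgue_measure `[0, b] (fun u => g (nu u)))) : C).
Proof.
(* Integers at distance less than 1 are equal; this makes [g] composed with [nu] right-continuous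
   for any [g]. *)
have near_const t : 0 <= t -> \forall x \near t^'+, nu x = nu t.
  move=> t0; have /cvgrPdist_lt/(_ 1 ltr01) := nu_right t0.
  apply: filterS => x; rewrite ltr_norml => /andP[h1 h2].
  by apply/eqP; rewrite eqn_leq -![(nu _ <= _)%N]ltnS -!(ltr_nat R) -!natr1;
    apply/andP; split; lra.
pose h m := b / m.+1%:R.
pose err m : R[i] := (c * h m)%:C * (g 0%N - g n).
have riemann : ((h m)%:C * \sum_(i < m.+1) g (nu (i.+1%:R * h m)) : C) @[m --> \oo] -->
    (cintegral lebesgue_measure `[0, b] (fun u => g (nu u)) : C).
  have gcvg (part : R[i] -> R) t : 0 <= t < b ->
      part (g (nu x)) @[x --> t^'+] --> part (g (nu t)).
    move=> /andP[t0 _]; apply: cvg_near_cst.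
    by apply: filterS (near_const t t0) => x ->.
  apply: (@riemann_right _ (fun u => g (nu u)) _ gbound b0).
  - exact: gcvg.
  - exact: gcvg.
  - move=> m i im; apply: le_trans (norm_le_ReIm _) _.
    by rewrite lecR gb// nu_le.
have err0 : (err m : C) @[m --> \oo] --> (0 : C).
  rewrite -[X in _ --> X](mul0r (g 0%N - g n)); apply: cvgM; last exact: cvg_cst.
  have hc : c * h m @[m --> \oo] --> (0 : R).
    rewrite -[X in _ --> X](mulr0 c); apply: cvgM; first exact: cvg_cst.
    rewrite -[X in _ --> X](mulr0 b); apply: cvgM; first exact: cvg_cst.
    exact: cvg_harmonic.
  by apply/cvg_complexP; split=> //=; exact: cvg_cst.
have -> : (fun m => \prod_(i < m.+1) cexp (- ((c * (b / m.+1%:R))%:C * g (nu (node m i))))) =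
    (fun m => cexp (- (c%:C * ((h m)%:C * \sum_(i < m.+1) g (nu (i.+1%:R * h m))) + err m))).
  apply/funext => m; rewrite -cexp_sum sumrN -mulr_sumr; congr (cexp (- _)).
  have shift : \sum_(i < m.+1) (g (nu (node m i.+1)) - g (nu (node m i))) = g n - g 0%N.
    rewrite -(big_mkord xpredT (fun i => g (nu (node m i.+1)) - g (nu (node m i)))).
    by rewrite (telescope_sumr (fun i => g (nu (node m i))))// node_last nub mul0r nu0.
  rewrite /err /h -(opprB (g n)) -shift sumrB.
  move: (\sum_(i < m.+1) g (nu (node m i.+1))) (\sum_(i < m.+1) g (nu (node m i))).
  by move=> s1 s0; rewrite !rmorphM/=; ring.
apply: continuous_cexp; apply: cvgN; rewrite -[X in _ --> X]addr0.
apply: cvgD; last exact: err0.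
by apply: cvgM; [exact: cvg_cst|exact: riemann].
Qed.

Lemma norm_counting_product m :
  `|\prod_(i < m.+1) cexp (- ((c * (b / m.+1%:R))%:C * g (nu (node m i)))) |
    <= (expR (c * b * gbound))%:C.
Proof.
rewrite -cexp_sum norm_cexp lecR ler_expR Re_sum.
have -> : c * b * gbound = \sum_(i < m.+1) c * (b / m.+1%:R) * gbound.
  rewrite sumr_const card_ord -mulr_natr; field; by rewrite nat1r pnatr_eq0.
apply: ler_sum => i _; rewrite ReN ReM /= mul0r subr0 -mulrN.
have h0 : 0 <= c * (b / m.+1%:R) by rewrite mulr_ge0 ?divr_ge0// ltW.
rewrite ler_wpM2l// (le_trans (ler_norm _))// normrN.
by rewrite (le_trans _ (gb (nu_le (ltnW (ltn_ord i)))))// lerDl.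
Qed.

End CountingPath.

End PathLimits.

Section PoissonLimit.
Context (R : realType) d (T : measurableType d) (Q : probability T R).
Variables (N : R -> T -> nat) (g : nat -> R[i]) (c b : R) (n : nat).
Hypotheses (poissonN : standard_poisson_process Q N)
  (QN0 : (0 < Q [set w | N 0%R w = 0%N])%E) (c0 : 0 < c) (b0 : 0 < b).
Local Notation A := [set w | N 0 w = 0%N].
Local Notation C := (R[i] : numFieldType).

(** Monotonicity is claimed only along the nodes of all the meshes: these are countably many pairs
    of times, so their null sets add up to a null set. *)
Lemma poisson_regular_ae : {ae Q, forall w,
  (forall t, 0 <= t -> (N x w)%:R @[x --> t^'+] --> ((N t w)%:R : R)) /\
  forall m i, (N (i%:R * (b / m.+1%:R)) w <= N (i.+1%:R * (b / m.+1%:R)) w)%N}.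
Proof.
have right : {ae Q, forall w, forall t, 0 <= t ->
    (N x w)%:R @[x --> t^'+] --> ((N t w)%:R : R)}.
  by case: poissonN => -[_ _ _ cad] _; apply: filterS cad => w [].
have mono : {ae Q, forall w, forall m i,
    (N (i%:R * (b / m.+1%:R)) w <= N (i.+1%:R * (b / m.+1%:R)) w)%N}.
  apply: ae_foralln => m; apply: ae_foralln => i.
  have h0 : 0 < b / m.+1%:R by rewrite divr_gt0.
  have [||mD D0] := @poisson_decreasing_null _ _ _ _ _ poissonN
    (i%:R * (b / m.+1%:R)) (i.+1%:R * (b / m.+1%:R)).
  - by rewrite mulr_ge0// ltW.
  - by rewrite ltr_pM2r// ltr_nat.
  by eexists; split; [exact: mD|exact: D0|move=> w /=; move/negP; rewrite -ltnNge].
by apply: filterS2 right mono => w h1 h2; split.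
Qed.

(** Used with [c] = 1 / lambda and [b] = lambda v. The indicator splits the pointwise limit: off the
    event N_b = n all terms vanish, and on it the path has the end value that the estimates for a
    counting path require. *)
Lemma poisson_functional_cvg :
  (\sum_(k : {ffun 'I_m.+1 -> 'I_n.+1} | (\sum_i k i == n)%N)
    \prod_(i < m.+1) ((poisson_pmf (b / m.+1%:R) (k i))%:C *
      cexp (- ((c * (b / m.+1%:R))%:C * g (\sum_(j < i) nat_of_ffun k j)%N))) : C)
    @[m --> \oo] -->
  (cond_expectation Q A (fun w =>
    cexp (- (c%:C * cintegral lebesgue_measure `[0, b] (fun u => g (N u w)))) *
    (\1_[set w' | N b w' = n] w)%:C) : C).
Proof.
have [Z [mZ Z0 Zbad]] := poisson_regular_ae.
have d0 m : 0 < b / m.+1%:R by rewrite divr_gt0.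
have mA : measurable A by exact: (poisson_start_measurable poissonN).
pose G m l := cexp (- ((c * (b / m.+1%:R))%:C * g l)).
pose f m w := \sum_(k : {ffun 'I_m.+1 -> 'I_n.+1} | (\sum_i k i == n)%N)
  (\prod_(i < m.+1) G m (\sum_(j < i) nat_of_ffun k j)%N) *
  (\1_(poisson_path N (b / m.+1%:R) m.+1 (nat_of_ffun k)) w)%:C.
under eq_fun => m do rewrite -(poisson_functional poissonN QN0 (d0 m) m.+1 n (G m)).
have good w : ~ Z w ->
    (forall t, 0 <= t -> (N x w)%:R @[x --> t^'+] --> ((N t w)%:R : R)) /\
    forall m i, (N (i%:R * (b / m.+1%:R)) w <= N (i.+1%:R * (b / m.+1%:R)) w)%N.
  by move=> nZ; apply: contrapT => bad; apply: nZ; exact: Zbad.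
have fE m w : A w -> ~ Z w -> f m w =
    (\prod_(i < m.+1) G m (N (i%:R * (b / m.+1%:R)) w)) *
    (\1_[set w' | N b w' = n] w)%:C.
  move=> Aw /good[_ mono]; rewrite /f.
  have <- := poisson_path_decomposition n (G m) Aw (fun i (_ : (i < m.+1)%N) => mono m i).
  by rewrite [m.+1%:R * _]mulrC divfK// pnatr_eq0.
apply: (@cond_expectation_bounded_cvg _ _ _ Q A mA Z f _
  (expR (c * b * \sum_(l < n.+1) (`|complex.Re (g l)| + `|complex.Im (g l)|)))) => //.
- move=> m; apply: bounded_measurable_sum => k _.
  apply: bounded_measurableM; first exact: bounded_measurable_cst.
  by apply: bounded_measurable_indic; exact: (poisson_path_measurable poissonN (d0 m)).
- move=> m w Aw nZ; rewrite fE//; have [_ mono] := good w nZ.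
  have [Nb|Nb] := pselect (N b w = n); last first.
    by rewrite indic0C// mulr0 normr0 ler0c expR_ge0.
  rewrite indic1C// mulr1.
  exact: (@norm_counting_product _ (fun t => N t w) g c b n c0 b0 Nb mono).
- move=> w Aw nZ; have [right mono] := good w nZ.
  have [Nb|Nb] := pselect (N b w = n); last first.
    have -> : f ^~ w = fun=> 0 by apply/funext => m; rewrite fE// indic0C// mulr0.
    by rewrite indic0C// mulr0; exact: cvg_cst.
  have -> : f ^~ w = fun m => \prod_(i < m.+1) G m (N (i%:R * (b / m.+1%:R)) w).
    by apply/funext => m; rewrite fE// indic1C// mulr1.
  rewrite indic1C// mulr1.
  exact: (@counting_riemann_product _ (fun t => N t w) g c b n b0 Aw Nb right mono).
Qed.

End PoissonLimit.

Section LevyTimeIntegral.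
Context (R : realType) d (T : measurableType d) (P : probability T R).
Variables (X : R -> T -> R) (alpha v : R).
Hypotheses (levyX : levy_process P X) (v0 : 0 < v).
Local Notation C := (R[i] : numFieldType).

Definition oscillatory_sum (m : nat) (w : T) : R[i] :=
  (v / m.+1%:R)%:C *
  \sum_(i < m.+1) cexp ('i%C * (alpha * X (i.+1%:R * (v / m.+1%:R)) w)%:C).

Lemma oscillatory_sum_measurable m : bounded_measurable (oscillatory_sum m).
Proof.
apply: bounded_measurableM; first exact: bounded_measurable_cst.
apply: bounded_measurable_sum => i _; apply: bounded_measurable_cexp_i.
apply: measurable_funM => //; apply: (levy_measurable levyX).
by rewrite mulr_ge0 ?divr_ge0// ltW.
Qed.

Lemma norm_oscillatory_sum_le m w : `|oscillatory_sum m w| <= v%:C.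
Proof.
exact: (norm_oscillatory_sum (fun i => alpha * X (i.+1%:R * (v / m.+1%:R)) w) m v0).
Qed.

(* The paths are regular only almost surely, so the time integral itself may
   fail to be measurable; [J] is a measurable version of it. *)
Lemma measurable_time_integral : exists Z (J : T -> R[i]),
  [/\ measurable Z /\ P Z = 0%E, bounded_measurable J, forall w, `|J w| <= v%:C,
    (forall w, ~ Z w -> J w = cintegral lebesgue_measure `[0, v]
      (fun u => cexp ('i%C * (alpha * X u w)%:C)))
  & forall w, ~ Z w -> (oscillatory_sum m w : C) @[m --> \oo] --> (J w : C)].
Proof.
have [Z [mZ Z0 Zbad]] : {ae P, forall w, cadlag (X ^~ w)} by case: levyX.
pose I w := cintegral lebesgue_measure `[0, v]
  (fun u => cexp ('i%C * (alpha * X u w)%:C)).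
(* Cutting both the sums and their limit to zero on [Z] gives convergence at every point, hence a
   measurable limit. *)
pose J w := (\1_(~` Z) w)%:C * I w.
pose J_ m w := (\1_(~` Z) w)%:C * oscillatory_sum m w.
have JE w : ~ Z w -> J w = I w by move=> nZ; rewrite /J indic1C// mul1r.
have sumI w : ~ Z w -> (oscillatory_sum m w : C) @[m --> \oo] --> (I w : C).
  move=> nZ; apply: oscillatory_riemann_sum => //.
  by have [] : cadlag (X ^~ w) by apply: contrapT => bad; apply: nZ; exact: Zbad.
have J_J w : (J_ m w : C) @[m --> \oo] --> (J w : C).
  have [nZ|nnZ] := pselect ((~` Z) w).
    rewrite JE// (_ : J_ ^~ w = oscillatory_sum ^~ w); first exact: sumI.
    by apply/funext => m; rewrite /J_ indic1C// mul1r.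
  rewrite /J indic0C// mul0r (_ : J_ ^~ w = fun=> 0); first exact: cvg_cst.
  by apply/funext => m; rewrite /J_ indic0C// mul0r.
have J_v m w : `|J_ m w| <= v%:C.
  rewrite /J_; have [nZ|nnZ] := pselect ((~` Z) w).
    by rewrite indic1C// mul1r; exact: norm_oscillatory_sum_le.
  by rewrite indic0C// mul0r normr0 ler0c ltW.
have mJ_ m : bounded_measurable (J_ m).
  apply: bounded_measurableM; last exact: oscillatory_sum_measurable.
  by apply: bounded_measurable_indic; exact: measurableC.
exists Z, J; split.
- by split.
- exact: (bounded_measurable_cvg mJ_ J_v J_J).
- by move=> w; exact: (norm_lim_le (J_J w) (J_v ^~ w)).
- exact: JE.
- by move=> w nZ; rewrite JE//; exact: sumI.
Qed.

End LevyTimeIntegral.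

(* [series term] converges for the topology of the modulus, obtained from the
   [numFieldType] structure of [R[i]]. *)
Theorem corollary3p2 (R : realType)
    (dN : measure_display) (TN : measurableType dN) (Q : probability TN R)
    (N : R -> TN -> nat)
    (dX : measure_display) (TX : measurableType dX) (P : probability TX R)
    (X : R -> TX -> R) (Phi : R -> R[i]) (alpha lambda v : R) :
  standard_poisson_process Q N -> (0 < Q [set w | N 0%R w = 0%N])%E ->
  levy_process P X -> (0 < P [set w | X 0%R w = 0%R])%E ->
  characteristic_exponent P X Phi ->
  0 < lambda -> 0 < v ->
  let term (n : nat) : (R[i] : numFieldType) :=
    cond_expectation Q [set w | N 0 w = 0%N] (fun w =>
      cexp (- ((lambda^-1)%:C *
               cintegral lebesgue_measure `[0, lambda * v]
                 (fun u => Phi (alpha * (n%:R - (N u w)%:R)))))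
      * (\1_[set w' | N (lambda * v) w' = n] w)%:C) in
  cvgn (series term) /\
  cond_expectation P [set w | X 0 w = 0] (fun w =>
    cexp (lambda%:C *
          cintegral lebesgue_measure `[0, v]
            (fun u => cexp ('i%C * (alpha * X u w)%:C))))
  = cexp ((lambda * v)%:C) * limn (series term).
Proof.
move=> poissonN QN0 levyX PX0 charX l0 v0 term.
have lv0 : 0 < lambda * v by rewrite mulr_gt0.
have li0 : 0 < lambda^-1 by rewrite invr_gt0.
have mA : measurable [set w | X 0 w = 0] by exact: (levy_start_measurable levyX).
pose E := cond_expectation P [set w | X 0 w = 0].
have [Z [J [[mZ Z0] mJ Jv JI sumJ]]] := measurable_time_integral alpha levyX v0.
(* For fixed n the two sides are limits of one and the same sequence, by the discrete identity with
   h = v / (m + 1). *)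
have moment n : (lambda ^+ n)%:C * (n`!%:R)^-1 * E (fun w => J w ^+ n) =
    cexp ((lambda * v)%:C) * term n.
  have lim1 : ((lambda ^+ n)%:C * (n`!%:R)^-1 *
      E (fun w => oscillatory_sum X alpha v m w ^+ n) : (R[i] : numFieldType))
      @[m --> \oo] -->
      ((lambda ^+ n)%:C * (n`!%:R)^-1 * E (fun w => J w ^+ n) : (R[i] : numFieldType)).
    apply: cvgM; first exact: cvg_cst.
    apply: (@cond_expectation_bounded_cvg _ _ _ P _ mA Z
      (fun m w => oscillatory_sum X alpha v m w ^+ n) (fun w => J w ^+ n) (v ^+ n)) => //.
    - by move=> m; apply: bounded_measurableX; exact: (oscillatory_sum_measurable alpha levyX v0).
    - move=> m w _ _; have le := norm_oscillatory_sum_le X alpha v0 m w.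
      rewrite normrX rmorphXn/=; apply: lerXn2r => //.
      by rewrite nnegrE (le_trans _ le).
    - move=> w _ nZ; elim: (n) => [|k IH]; first exact: cvg_cst.
      rewrite (_ : (fun m => _) = fun m => oscillatory_sum X alpha v m w *
        oscillatory_sum X alpha v m w ^+ k).
        by rewrite exprS; apply: cvgM; [exact: sumJ|exact: IH].
      by apply/funext => m; rewrite exprS.
  pose S m := \sum_(k : {ffun 'I_m.+1 -> 'I_n.+1} | (\sum_i k i == n)%N)
    \prod_(i < m.+1) ((poisson_pmf (lambda * v / m.+1%:R) (k i))%:C *
      cexp (- ((lambda^-1 * (lambda * v / m.+1%:R))%:C *
        Phi (alpha * (n%:R - (\sum_(j < i) nat_of_ffun k j)%N%:R))))).
  have lim2 : (cexp ((lambda * v)%:C) * S m : (R[i] : numFieldType)) @[m --> \oo] -->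
      (cexp ((lambda * v)%:C) * term n : (R[i] : numFieldType)).
    apply: cvgM; first exact: cvg_cst.
    exact: (@poisson_functional_cvg _ _ _ Q N (fun l => Phi (alpha * (n%:R - l%:R)))
      lambda^-1 (lambda * v) n poissonN QN0 li0 lv0).
  have seqE : (fun m => (lambda ^+ n)%:C * (n`!%:R)^-1 *
      E (fun w => oscillatory_sum X alpha v m w ^+ n)) =
      (fun m => cexp ((lambda * v)%:C) * S m).
    apply/funext => m; have h0 : 0 < v / m.+1%:R by rewrite divr_gt0.
    rewrite (discrete_moment_identity levyX PX0 charX alpha m.+1 n l0 h0).
    have -> : m.+1%:R * (lambda * (v / m.+1%:R)) = lambda * v.
      by field; rewrite nat1r pnatr_eq0.
    congr (_ * _); apply: eq_bigr => k _; apply: eq_bigr => i _.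
    by rewrite -mulrA mulKf// gt_eqF.
  rewrite seqE in lim1.
  exact: (@cvg_unique (R[i] : numFieldType) (@norm_hausdorff _ _) _ _ _ _ lim1 lim2).
pose z w := lambda%:C * J w.
have mz : bounded_measurable z.
  by apply: bounded_measurableM => //; exact: bounded_measurable_cst.
have mterm k : bounded_measurable (fun w => (k`!%:R)^-1 * z w ^+ k : R[i]).
  apply: bounded_measurableM; first exact: bounded_measurable_cst.
  exact: bounded_measurableX.
have zb w : `|z w| <= (lambda * v)%:C.
  rewrite /z normrM norm_real_complex (ger0_norm (ltW l0)) rmorphM/=.
  by apply: ler_wpM2l => //; rewrite ler0c ltW.
(* The constant exp (lambda v) dominates all partial sums, since the modulus of [z] is at most
   lambda v. *)
have lim : (E (fun w => \sum_(k < M) (k`!%:R)^-1 * z w ^+ k) : (R[i] : numFieldType))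
    @[M --> \oo] --> (E (fun w => cexp (z w)) : (R[i] : numFieldType)).
  apply: (@cond_expectation_bounded_cvg _ _ _ P _ mA Z
    (fun M w => \sum_(k < M) (k`!%:R)^-1 * z w ^+ k) (fun w => cexp (z w))
    (expR (lambda * v))) => //.
  - by move=> M; apply: bounded_measurable_sum => k _; exact: mterm.
  - by move=> M w _ _; exact: norm_exp_partial_sum.
  - by move=> w _ _; exact: cexp_series.
(* An exact identity of partial sums, so the convergence of the series and its value are obtained
   together. *)
have seriesE : series term = fun M => cexp (- (lambda * v)%:C) *
    E (fun w => \sum_(k < M) (k`!%:R)^-1 * z w ^+ k).
  apply/funext => M; rewrite /series/= big_mkord.
  have -> : E (fun w => \sum_(k < M) (k`!%:R)^-1 * z w ^+ k) =
      \sum_(k < M) E (fun w => (k`!%:R)^-1 * z w ^+ k).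
    by apply: cond_expectation_sum => // k _; exact: mterm.
  rewrite mulr_sumr; apply: eq_bigr => k _; apply: (mulfI (cexp_neq0 ((lambda * v)%:C))).
  rewrite -moment [RHS]mulrA -cexpD subrr cexp0 mul1r /E.
  rewrite -(cond_expectationZ P mA _ (bounded_measurableX k mJ)).
  apply: eq_cond_expectation => w _.
  by rewrite /z exprMn rmorphXn/= mulrA [_^-1 * _]mulrC.
have limS : series term @ \oo -->
    (cexp (- (lambda * v)%:C) * E (fun w => cexp (z w)) : (R[i] : numFieldType)).
  by rewrite seriesE; apply: cvgM; [exact: cvg_cst|exact: lim].
split; first exact: cvgP limS.
rewrite (cvg_lim _ limS); last exact: norm_hausdorff.
(* What remains is to replace the measurable version [J] by the time integral itself, which agrees
   with it off [Z]. *)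
rewrite mulrA -cexpD subrr cexp0 mul1r /E /cond_expectation; congr (_ * _).
by apply: (cintegral_off_null mZ Z0) => w _ nZ; rewrite /z JI.
Qed.
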